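(* Let $R$ be an order in a number field of degree $d$ over $\mathbb Q$ and let $n\le k$ be positive integers. Then the density \[\lim_{N\to\infty}\frac{|\{(v_1,\dots,v_k)\in (R(N)^n)^k:\ v_1,\dots,v_k \text{ generate } R^n \text{ as an } R\text{-module}\}|}{(2N+1)^{dnk}}\] exists and equals $\prod_{j=k-n+1}^{k}\zeta_R(j)^{-1}$. In particular, the probability (density) that $k$ random elements of $\mathbb Z^n$ generate the group $\mathbb Z^n$ equals $\prod_{j=k-n+1}^{k}\zeta(j)^{-1}$, where $\zeta$ is the Riemann zeta function.
   Context: An order $R$ in a number field is a subring free of rank $d$ as a $\mathbb Z$-module; fix a $\mathbb Z$-basis $w_1,\dots,w_d$ and set $R(N)=\{\sum r_iw_i: r_i\in\mathbb Z, |r_i|\le N\}$. Define $\zeta_R(s)=\prod_{\mathfrak p\in\operatorname{mSpec}R}(1-|R/\mathfrak p|^{-s})^{-1}$, with the convention $\zeta_R(1)^{-1}=0$ (so the density is $0$ when $k=n$). *)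

(* Defs.v *)
From Stdlib Require Import Reals ClassicalEpsilon.
From Stdlib Require Lists.List.
From HB Require Import structures.
From mathcomp Require Import all_boot all_order all_algebra all_field.

Set Implicit Arguments.
Unset Strict Implicit.
Unset Printing Implicit Defensive.

Import GRing.Theory.

Definition decP (P : Prop) : bool :=
  if excluded_middle_informative P then true else false.

Section Order.
Local Open Scope ring_scope.

Variables (K : fieldExtType rat) (d : nat) (w : d.-tuple K).

Definition inR (x : K) : Prop :=
  exists c : 'I_d -> int, x = \sum_(l < d) (c l)%:~R * tnth w l.

(* R = Z-span of w is an order of the number field K (of degree d over Q)
   with Z-basis w: K has Q-dimension d, w is Q-free, and the Z-span of w is
   a subring (contains 1, closed under multiplication; additive closure
   is automatic). *)
Definition is_order_with_basis : Prop :=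
  [/\ \dim (@fullv rat K) = d, free (w : seq K), inR 1
    & forall x y, inR x -> inR y -> inR (x * y)].

(* A coefficient array c encodes (v_1,...,v_k) in (R(N)^n)^k:
   the i-th coordinate of v_j is sum_l (c (j,i,l) - N) w_l, with
   c (j,i,l) in {0,...,2N}, i.e. coefficient in [-N, N].  Since w is
   free this is a bijection onto (R(N)^n)^k. *)
Definition coeffs (N n k : nat) := {ffun 'I_k * 'I_n * 'I_d -> 'I_(2 * N).+1}.

Definition vec_of (N n k : nat) (c : coeffs N n k) (j : 'I_k) (i : 'I_n) : K :=
  \sum_(l < d) ((c (j, i, l) : nat)%:Z - N%:Z)%:~R * tnth w l.

Definition generates (n k : nat) (v : 'I_k -> 'I_n -> K) : Prop :=
  forall u : 'I_n -> K, (forall i, inR (u i)) ->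
    exists a : 'I_k -> K, (forall j, inR (a j)) /\
      forall i, \sum_(j < k) a j * v j i = u i.

Definition gen_count (n k N : nat) : nat :=
  #|[set c : coeffs N n k | decP (generates (vec_of c))]|.

Definition is_ideal (P : K -> Prop) : Prop :=
  [/\ forall x, P x -> inR x, P 0,
      forall x y, P x -> P y -> P (x + y)
    & forall r x, inR r -> P x -> P (r * x)].

Definition same_ideal (P Q : K -> Prop) : Prop := forall x, P x <-> Q x.

Definition is_max_ideal (P : K -> Prop) : Prop :=
  [/\ is_ideal P, ~ (forall x, inR x -> P x)
    & forall Q, is_ideal Q -> (forall x, P x -> Q x) ->
        (forall x, inR x -> Q x) \/ same_ideal Q P].

Definition ideal_index (P : K -> Prop) (q : nat) : Prop :=
  exists r : 'I_q -> K,
    [/\ forall i, inR (r i),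
        forall i j, i != j -> ~ P (r i - r j)
      & forall x, inR x -> exists i, P (x - r i)].

End Order.

Section Zeta.
Variables (K : fieldExtType rat) (d : nat) (w : d.-tuple K).

Definition euler_prod (s : nat) (L : list ((K -> Prop) * nat)) : R :=
  List.fold_right (fun pq acc => Rmult (Rminus R1 (Rinv (pow (INR pq.2) s))) acc) R1 L.

(* z = zeta_R(s)^{-1} = prod_{p maximal} (1 - |R/p|^{-s}), the (countable)
   product being understood as the limit over finite sets of maximal ideals
   directed by inclusion (the sets exhausting those of norm <= X);
   convention zeta_R(1)^{-1} = 0. *)
Definition is_zeta_inv (s : nat) (z : R) : Prop :=
  if s == 1%N then z = R0 else
  forall eps : R, Rlt R0 eps -> exists X : nat,
    forall L : list ((K -> Prop) * nat),
      (forall pq, List.In pq L -> is_max_ideal w pq.1 /\ ideal_index w pq.1 pq.2) ->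
      List.ForallOrdPairs (fun a b => ~ same_ideal a.1 b.1) L ->
      (forall P q, is_max_ideal w P -> ideal_index w P q -> (q <= X)%N ->
         exists pq, List.In pq L /\ same_ideal pq.1 P) ->
      Rlt (Rabs (Rminus (euler_prod s L) z)) eps.

Definition density (n k : nat) (N : nat) : R :=
  Rdiv (INR (gen_count w n k N)) (INR (expn (2 * N).+1 (d * n * k))).

End Zeta.

(* Main.v *)
(** A tuple generates [R^n] iff its matrix has rank [n] modulo every maximal ideal: otherwise
    lift a right inverse from the residue field of a maximal ideal containing the ideal of all
    [x] with [A X = x I] for some [X], and use the adjugate. For finitely many maximal ideals
    the Chinese remainder theorem makes the rank conditions independent, which gives the
    partial Euler products as densities. When [n < k], matrices failing at a prime of large
    residue characteristic [p] are negligible: for [p] up to the box size by counting residues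
    (proportion [O(p^-2)], at most [d] ideals over each [p]); beyond the box size, all leading
    minors being nonzero outside a negligible set, only boundedly many ideals divide the
    relevant minor, and each of them determines a coordinate of the next entry. When [n = k],
    the determinant must be a unit, so its norm, a nonconstant polynomial in one coordinate
    of the last entry, is [1] or [-1]; hence the density is [0]. *)

From Stdlib Require Import Reals ClassicalEpsilon.
From HB Require Import structures.
From mathcomp Require Import all_boot all_order all_algebra all_field.
From mathcomp Require Import perm boolp Rstruct ring lra zify.
Require Import Defs.

Set Implicit Arguments.
Unset Strict Implicit.
Unset Printing Implicit Defensive.

Import Order.TTheory GRing.Theory Num.Theory.
Local Open Scope ring_scope.

(** * Orders as rings with coordinates and norms *)

(** The obstacle is uniformity over infinitely many maximal ideals. Counting residues in a box of
    side [B = 2N+1] costs a rounding factor that stays bounded only for moduli up to [B]. For larger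
    characteristics the spare column supplied by [n < k] decides: the leading minor of order [t+1]
    does not involve the entry in row [t] and column [t+1] (counted from 0), so it restricts the
    candidate ideals before that entry is chosen. Its substitute is the bound that the product of
    [|R/M|] over distinct maximal [M] containing a positive integer [m] is at most [m^d]. It yields
    the finite lists of ideals, the [d] ideals over each prime, and the bounded number of large
    ideals containing a given nonzero element. Negligible sets are all bounded by slicing: at most
    [m] points on each line parallel to one axis give [|E| B <= m B^D]. *)

Lemma decPP (P : Prop) : reflect P (decP P).
Proof. by rewrite /decP; case: excluded_middle_informative => ?; constructor. Qed.

Section OrderRing.
Variables (K : fieldExtType rat) (d : nat) (w : d.-tuple K).
Hypothesis hR : is_order_with_basis w.

(** The proof is an argument so that the ring structure, which depends on it, can be attached to
    [ordPred hR]. *)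
Definition ordPred of is_order_with_basis w : {pred K} := fun x => decP (inR w x).

Lemma ordPredP x : reflect (inR w x) (x \in ordPred hR).
Proof. exact: decPP. Qed.

Lemma ordPred_subring : subring_closed (ordPred hR).
Proof.
have [_ _ h1 hM] := hR; split; first exact/ordPredP.
- move=> x y /ordPredP[a ->] /ordPredP[b ->]; apply/ordPredP.
  exists (fun l => a l - b l); rewrite -sumrB; apply: eq_bigr => l _.
  by rewrite rmorphB /= mulrBl.
- by move=> x y /ordPredP hx /ordPredP hy; apply/ordPredP/hM.
Qed.

HB.instance Definition _ := GRing.isSubringClosed.Build K (ordPred hR) ordPred_subring.

Record RT := MkRT { rval :> K; rvalP : rval \in ordPred hR }.
HB.instance Definition _ := [isSub for rval].
HB.instance Definition _ := [Choice of RT by <:].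
HB.instance Definition _ := [SubChoice_isSubComNzRing of RT by <:].

Lemma rval_inR (x : RT) : inR w (rval x).
Proof. exact/ordPredP/rvalP. Qed.

Definition toRT (x : K) (h : inR w x) : RT := MkRT (introT (ordPredP x) h).

Lemma tnth_inR l : inR w (tnth w l).
Proof.
exists (fun i => (i == l)%:Z); rewrite (bigD1 l) //= eqxx mul1r big1 ?addr0 //.
by move=> i /negbTE ->; rewrite mul0r.
Qed.

Definition wR l : RT := toRT (tnth_inR l).

Definition lc (z : 'I_d -> int) : RT := \sum_l wR l *~ z l.

Lemma rval_sum I (r : seq I) (P : pred I) (F : I -> RT) :
  rval (\sum_(i <- r | P i) F i) = \sum_(i <- r | P i) rval (F i).
Proof. exact: (raddf_sum (val : RT -> K)). Qed.

Lemma rvalMz x z : rval (x *~ z) = rval x *~ z.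
Proof. exact: (raddfMz (val : RT -> K)). Qed.

Lemma rval_lc z : rval (lc z) = \sum_l (z l)%:~R * tnth w l.
Proof.
rewrite /lc rval_sum; apply: eq_bigr => l _.
by rewrite rvalMz mulrzl.
Qed.


Lemma w_free : free w.
Proof. by have [] := hR. Qed.

Lemma d_gt0 : (0 < d)%N.
Proof. 
have [e _ _ _] := hR; rewrite -e lt0n dimv_eq0; apply/negP => /eqP h.
by have := memvf (1 : K); rewrite h memv0 oner_eq0.
Qed.

(** Rational coordinates of elements of the order are integers because [w] is free, so taking the
    numerator loses nothing. *)
Definition coef (x : RT) (l : 'I_d) : int := numq (coord w l (rval x)).

Lemma coef_lc z : coef (lc z) =1 z.
Proof.
move=> l; rewrite /coef rval_lc.
under eq_bigr => i _ do rewrite mulrzl -scaler_int (tnth_nth 0).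
by rewrite coord_sum_free ?w_free // numq_int.
Qed.

Lemma lc_coef x : lc (coef x) = x.
Proof.
have [z hz] := rval_inR x; suff -> : x = lc z by congr lc; apply: funext => l; rewrite coef_lc.
by apply: val_inj; rewrite /= rval_lc.
Qed.

Lemma coefB x y l : coef (x - y) l = coef x l - coef y l.
Proof.
rewrite -{1}(lc_coef x) -{1}(lc_coef y) /lc -sumrB.
by under eq_bigr do rewrite -mulrzBr; rewrite -/(lc _) coef_lc.
Qed.

Lemma coef0 l : coef 0 l = 0. Proof. by rewrite -(subrr 0) coefB subrr. Qed.
Lemma coefN x l : coef (- x) l = - coef x l.
Proof. by rewrite -sub0r coefB coef0 sub0r. Qed.
Lemma coefD x y l : coef (x + y) l = coef x l + coef y l.
Proof. by rewrite -{1}[y]opprK coefB coefN opprK. Qed.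

Lemma coef_sum I (r : seq I) (P : pred I) (F : I -> RT) l :
  coef (\sum_(i <- r | P i) F i) l = \sum_(i <- r | P i) coef (F i) l.

by elim/big_ind2: _ => [|x1 z1 x2 z2 <- <-|//]; rewrite ?coef0 ?coefD.
Qed.

Lemma coefMz x z l : coef (x *~ z) l = coef x l * z.
Proof.
rewrite -{1}(lc_coef x) /lc mulrz_suml.
by under eq_bigr do rewrite -mulrzA; rewrite -/(lc _) coef_lc.
Qed.

Lemma wR_lc l : wR l = lc (fun m => (l == m)%:Z).
Proof.
rewrite /lc (bigD1 l) //= eqxx big1 ?addr0 // => i.
by rewrite eq_sym => /negbTE->.
Qed.

Lemma wR_neq0 l : wR l != 0.
Proof.
apply/eqP => /(congr1 (fun x => coef x l)).
by rewrite coef0 wR_lc coef_lc eqxx.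
Qed.

Definition mulmat (x : RT) : 'M[int]_d := \matrix_(l, m) coef (x * wR l) m.

Lemma mulmatE x l : x * wR l = \sum_m wR m *~ mulmat x l m.
Proof. by rewrite -{1}(lc_coef (x * wR l)); apply: eq_bigr => m _; rewrite mxE. Qed.

Lemma mulmatD x y : mulmat (x + y) = mulmat x + mulmat y.
Proof. by apply/matrixP=> l m; rewrite !mxE mulrDl coefD. Qed.

Lemma mulmatMz x z : mulmat (x *~ z) = z *: mulmat x.
Proof. by apply/matrixP=> l m; rewrite !mxE mulrzAl coefMz mulrC. Qed.

Lemma mulmat1 : mulmat 1 = 1%:M.
Proof.
apply/matrixP=> l m; rewrite !mxE mul1r.
by rewrite wR_lc coef_lc; case: eqP.
Qed.

(** Rows hold the images of the basis vectors, hence the reversed order. *)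
Lemma mulmatM x y : mulmat (x * y) = mulmat y *m mulmat x.
Proof.
apply/matrixP=> l m; rewrite !mxE -mulrA mulmatE mulr_sumr coef_sum.
by apply: eq_bigr => i _; rewrite mulrzAr coefMz mulrC !mxE.
Qed.

Definition nm x := \det (mulmat x).

Lemma nm1 : nm 1 = 1. Proof. by rewrite /nm mulmat1 det1. Qed.
Lemma nmM x y : nm (x * y) = nm x * nm y.
Proof. by rewrite /nm mulmatM det_mulmx mulrC. Qed.

Lemma nm_unit x y : x * y = 1 -> `|nm x|%N = 1%N.
Proof.
move=> h; have := congr1 (fun z => absz (nm z)) h.
by rewrite /= nmM nm1 abszM => /eqP; rewrite muln_eq1 => /andP[/eqP].
Qed.

(** Multiplying the system [x w_m = sum_j M_(m,j) w_j] by the adjugate of [M] shows that [x] divides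
    [det M * w_l] for every [l]; then [1] is expanded in the basis. *)
Lemma nm_dvd x : exists y, (nm x)%:~R = x * y.
Proof.
have hl l : exists y, wR l *~ nm x = x * y.
  exists (\sum_m wR m *~ (\adj (mulmat x)) l m).
  rewrite mulr_sumr; under eq_bigr => m _ do rewrite mulrzAr mulmatE mulrz_suml.
  rewrite exchange_big /=.
  transitivity (\sum_j wR j *~ (\adj (mulmat x) *m mulmat x) l j); last first.
    apply: eq_bigr => j _; rewrite !mxE mulrz_sumr; apply: eq_bigr => m _.
    by rewrite [in LHS]mulrC mulrzA.
  rewrite mul_adj_mx (bigD1 l) //= big1 ?addr0 ?mxE ?eqxx ?mulr1n // => j jl.
  by rewrite mxE eq_sym (negbTE jl).
have [y hy] := choice hl.
exists (\sum_l y l *~ coef 1 l).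
rewrite -[1 in LHS]lc_coef /lc mulr_sumr mulrz_suml; apply: eq_bigr => l _.
by rewrite -mulrzA mulrC mulrzA hy mulrzAr.
Qed.

Lemma absz_nm_dvd x : exists y, (absz (nm x))%:R = y * x.
Proof.
have [y hy] := nm_dvd x; exists ((sgz (nm x))%:~R * y).
rewrite -mulrA [y * x]mulrC -hy -intrM -[LHS]/((absz (nm x))%:~R); congr (_%:~R).
by rewrite mulrC abszEsg mulrC.
Qed.

Lemma rat_comb_eq0 (v : 'rV[rat]_d) : \sum_l v 0 l *: (wR l : K) = 0 -> v = 0.
Proof.
move=> h; apply/rowP=> l; rewrite mxE; apply: (freeP w_free (fun l => v 0 l)).
by rewrite -[RHS]h; apply: eq_bigr => i _; rewrite /= (tnth_nth 0).
Qed.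

(** A rational kernel vector [v] of the matrix would give [x * sum v_l w_l = 0] in the field [K],
    against the freeness of [w]. *)
Lemma nm_neq0 x : x != 0 -> nm x != 0.
Proof.
move=> x0; apply/negP => /eqP h.
have /det0P[v v0 hv] : \det (map_mx (intr : int -> rat) (mulmat x)) == 0.
  by rewrite det_map_mx -/(nm x) h.
case/negP: v0; apply/eqP/rat_comb_eq0.
have x0' : (x : K) != 0 by apply: contra x0 => /eqP h0; apply/eqP/val_inj.
apply: (mulfI x0'); rewrite mulr0 mulr_sumr.
transitivity (\sum_j (v *m map_mx intr (mulmat x)) 0 j *: (wR j : K)); last first.
  by rewrite hv big1 // => j _; rewrite mxE scale0r.
under [RHS]eq_bigr do rewrite !mxE scaler_suml.
rewrite exchange_big /=; apply: eq_bigr => l _.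
rewrite -scalerAr -[_ * tnth _ _]/(rval (x * wR l)) mulmatE.
rewrite rval_sum scaler_sumr; apply: eq_bigr => m _.
by rewrite rvalMz !mxE /= -scaler_int scalerA.
Qed.

(** Up to the factor [det (f b)], the norm of [a + b t] is a characteristic polynomial of degree [d]
    evaluated at [t]. Norms [1] and [-1] are therefore roots of a product of two polynomials of
    degree [d], which is where [2 * d] comes from; [d > 0] keeps the degree when the constant is
    added. *)
Lemma nm_line_unit (a b : RT) (s : seq int) : b != 0 -> uniq s ->
  (forall t, t \in s -> absz (nm (a + b *~ t)) = 1%N) -> (size s <= 2 * d)%N.
Proof.
move=> b0 us hs.
pose f x := map_mx (intr : int -> rat) (mulmat x).
have dB : \det (f b) != 0 by rewrite det_map_mx intr_eq0 nm_neq0.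
pose N := - (invmx (f b) *m f a).
have dN (t : int) : (nm (a + b *~ t))%:~R = \det (f b) * (char_poly N).[t%:~R].
  have -> : (char_poly N).[t%:~R] = \det (t%:~R%:M - N).
    rewrite -/(horner_eval _ _) /char_poly -det_map_mx; congr (\det _).
    apply/matrixP => i j; rewrite !mxE /= /horner_eval hornerD hornerN hornerC.
    by rewrite hornerMn hornerX.
  rewrite -det_mulmx -det_map_mx mulmatD mulmatMz; congr (\det _).
  rewrite mulmxBr mul_mx_scalar mulmxN opprK mulmxA mulmxV ?unitmxE ?unitfE //.
  by rewrite mul1mx map_mxD map_mxZ addrC.
pose c : rat := (\det (f b))^-1.
pose q := (char_poly N - c%:P) * (char_poly N + c%:P).
have szc (e : rat) : size (char_poly N + e%:P) = d.+1.
  rewrite size_polyDl size_char_poly // (leq_ltn_trans (size_polyC_leq1 _)) //.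
  by rewrite ltnS d_gt0.
have szq : size q = (2 * d).+1.
  rewrite size_mul -?size_poly_eq0 -?polyCN ?szc //.
  by rewrite addnS /= addSn mul2n addnn.
have q0 : q != 0 by rewrite -size_poly_eq0 szq.
rewrite -(size_map (intr : int -> rat)) -ltnS -szq; apply: max_poly_roots => //.
  apply/allP => _ /mapP[t ts ->]; rewrite rootM /root !hornerD hornerN hornerC.
  have hn : nm (a + b *~ t) = 1 \/ nm (a + b *~ t) = -1 by have := hs t ts; lia.
  rewrite subr_eq0 addr_eq0 /c.
  case: hn => hn; have := dN t; rewrite hn => /esym h.
    by apply/orP; left; apply/eqP; rewrite -[LHS](mulKf dB) h mulr1.
  apply/orP; right; apply/eqP.
  by rewrite -[LHS](mulKf dB) h rmorphN mulrN mulr1.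
by rewrite map_inj_uniq //; apply: intr_inj.
Qed.

Definition bnd (x : RT) (b : nat) := forall l, `|coef x l| <= b%:Z.

Lemma bnd_sum I (r : seq I) (P : pred I) (F : I -> RT) (B : I -> nat) :
  (forall i, P i -> bnd (F i) (B i)) ->
  bnd (\sum_(i <- r | P i) F i) (\sum_(i <- r | P i) B i).
Proof.
move=> h l; rewrite coef_sum (le_trans (ler_norm_sum _ _ _)) //.
by rewrite (raddf_sum Posz) /=; apply: ler_sum => i /h.
Qed.

Lemma bndMz x b z : bnd x b -> bnd (x *~ z) (b * `|z|%N).
Proof. by move=> h l; rewrite coefMz normrM PoszM abszE ler_pM. Qed.

Lemma bnd_le x a b : (a <= b)%N -> bnd x a -> bnd x b.
Proof. by move=> ab h l; apply: le_trans (h l) _; rewrite lez_nat. Qed.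

Lemma bnd_ex x : exists b, bnd x b.
Proof.
exists (\sum_l `|coef x l|%N)%N => l; rewrite -abszE lez_nat (bigD1 l) //=.
exact: leq_addr.
Qed.

(** The constant sums the sizes of all the structure constants of the basis. *)
Lemma bndM : exists C, forall x y a b, bnd x a -> bnd y b -> bnd (x * y) (C * (a * b))%N.
Proof.
have [B hB] := choice (fun p : 'I_d * 'I_d => bnd_ex (wR p.1 * wR p.2)).
exists (\sum_l \sum_m B (l, m))%N => x y a b hx hy.
rewrite -(lc_coef x) -(lc_coef y) /lc big_distrl big_distrl /=.
apply: bnd_sum => l _; rewrite big_distrr big_distrl /=; apply: bnd_sum => m _.
rewrite mulrzAl mulrzAr -mulrzA; apply: bnd_le (bndMz _ (hB (l, m))).
rewrite leq_mul2l abszM mulnC; apply/orP; right.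
by apply: leq_mul; rewrite -lez_nat abszE; [apply: hx | apply: hy].
Qed.

Lemma bnd_prod t : exists C, forall (F : 'I_t -> RT) b, (forall i, bnd (F i) b) ->
  bnd (\prod_i F i) (C * b ^ t)%N.
Proof.
have [C hC] := bndM.
elim: t => [|t [C1 h1]].
  have [B hB] := bnd_ex 1; exists B => F b _.
  by rewrite big_ord0 expn0 muln1.
exists (C * C1)%N => F b hF; rewrite big_ord_recl.
apply: bnd_le (hC _ _ _ _ (hF _) (h1 _ b (fun i => hF (lift ord0 i)))).
by rewrite expnS -mulnA (mulnCA C1).
Qed.

Lemma bnd_det t : exists C, forall (A : 'M[RT]_t) b, (forall i j, bnd (A i j) b) ->
  bnd (\det A) (C * b ^ t)%N.
Proof.
have [C hC] := bnd_prod t; exists (#|{: 'S_t}| * C)%N => A b hA.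
rewrite /determinant -mulnA -sum_nat_const; apply: bnd_sum => s _.
have h : bnd (\prod_i A i (s i)) (C * b ^ t) by apply: hC.
by rewrite mulr_sign; case: (odd_perm s) => // l; rewrite coefN normrN.
Qed.

Lemma nm_bnd : exists C, forall x b, bnd x b -> (absz (nm x) <= C * b ^ d)%N.
Proof.
have [C hC] := bndM.
have [B hB] := choice (fun l : 'I_d => bnd_ex (wR l)).
pose D := (C * \sum_l B l)%N.
exists (#|{: 'S_d}| * D ^ d)%N => x b hx; rewrite -lez_nat abszE.
rewrite /nm /determinant (le_trans (ler_norm_sum _ _ _)) //.
rewrite -mulnA -expnMn -sum_nat_const (raddf_sum Posz) /=; apply: ler_sum => s _.
rewrite normrM normrX normrN1 expr1n mul1r normr_prod.
rewrite -[in (_ ^ d)%N](card_ord d) -prod_nat_const (rmorph_prod Posz) /=.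
apply: ler_prod => i _; rewrite normr_ge0 !mxE.
apply: le_trans (hC _ _ _ _ hx (hB i) _) _.
by rewrite lez_nat /D -mulnA leq_mul2l mulnC leq_mul2r (bigD1 i) //= leq_addr !orbT.
Qed.

Lemma nm_det_bnd t : exists C e, forall (A : 'M[RT]_t) b,
  (forall i j, bnd (A i j) b) -> (absz (nm (\det A)) <= C * b ^ e)%N.
Proof.
have [C1 h1] := bnd_det t; have [C2 h2] := nm_bnd.
exists (C2 * C1 ^ d)%N, (t * d)%N => A b hA.
by rewrite (leq_trans (h2 _ _ (h1 _ _ hA))) // expnMn expnM mulnA.
Qed.
End OrderRing.

(** * Maximal ideals and residue fields *)

Section MaximalIdeals.
Variables (K : fieldExtType rat) (d : nat) (w : d.-tuple K).
Hypothesis hR : is_order_with_basis w.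
Notation RR := (RT hR).

Lemma ideal_RT (P : K -> Prop) : is_ideal w P ->
  [/\ P (rval (0 : RR)), forall x y : RR, P x -> P y -> P (rval (x + y)),
      forall a x : RR, P x -> P (rval (a * x)) & forall x y : RR, P x -> P y -> P (rval (x - y))].
Proof.
move=> [h1 h2 h3 h4]; split=> //.
- by move=> x y; apply: h3.
- by move=> a x; apply: (h4 (rval a)); apply: rval_inR.
move=> x y hx hy; apply: (h3 (rval x) (- rval y)) => //.
have -> : - rval y = rval (-1 : RR) * rval y by rewrite /= mulN1r.
by apply: h4 => //; apply: rval_inR.
Qed.

Lemma toRTK (r : K) : inR w r -> exists x : RR, r = rval x.
Proof. by move=> h; exists (toRT hR h). Qed.

(** This is [J + xR], the enlargement against which maximality is tested. *)
Lemma mul_ideal (x : RR) (J : K -> Prop) : is_ideal w J ->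
  is_ideal w (fun u => exists2 a : RR, J a & exists y : RR, u = rval (a + x * y)).
Proof.
move=> hJ; have [j0 jD jM _] := ideal_RT hJ; split.
- by move=> _ [a _ [y ->]]; apply: rval_inR.
- by exists 0 => //; exists 0; rewrite mulr0 addr0.
- move=> _ _ [a ja [y ->]] [b jb [z ->]]; exists (a + b); first exact: jD.
  by exists (y + z); rewrite -[_ + _]/(rval ((a + x * y) + (b + x * z))) mulrDr addrACA.
- move=> _ _ /toRTK[r ->] [a ja [y ->]]; exists (r * a); first exact: jM.
  by exists (r * y); rewrite -[_ * _]/(rval (r * (a + x * y))) mulrDr mulrCA.
Qed.

Lemma proper_ideal1 P : is_ideal w P -> (~ (forall x, inR w x -> P x)) <-> ~ P (rval (1 : RR)).
Proof.
move=> hP; have [_ _ _ h] := hP; split=> hn h1; apply: hn; last exact/h1/rval_inR.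
by move=> x /h /(_ h1); rewrite mulr1.
Qed.

Lemma ideal_nat P (x : RR) : is_ideal w P -> P x -> x != 0 ->
  exists2 m, (0 < m)%N & P (rval (m%:R : RR)).
Proof.
move=> hP hx x0; exists (absz (nm x)); first by rewrite absz_gt0 nm_neq0.
have [y ->] := absz_nm_dvd x; have [_ _ h _] := ideal_RT hP.
exact: h.
Qed.

(** If [2] were invertible, the coordinate [1] of [w_l] would be even. This excludes that the order
    is a field. *)
Lemma two_not_unit (y : RR) : 1 <> 2%:R * y.
Proof.
move=> h; have l : 'I_d := Ordinal (d_gt0 hR).
have : wR hR l = (y * wR hR l) *~ 2.
  by rewrite -mulrzAl -mulrzl -h mul1r.
move=> /(congr1 (fun x => coef x l)); rewrite coefMz.
by rewrite wR_lc coef_lc eqxx; lia.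
Qed.

(** If [P] has no nonzero element, then [P + 2R] is still proper because [2] is not a unit, so
    maximality makes it equal to [P] and puts [2] in [P]. Otherwise the norm of a nonzero element
    works. *)
Lemma max_ideal_nat P : is_max_ideal w P ->
  exists2 m, (0 < m)%N & P (rval (m%:R : RR)).
Proof.
move=> [hP hprop hmax].
have [[x [x0 hx]]|hno] := pselect (exists x : RR, x != 0 /\ P x).
  exact: ideal_nat hP hx x0.
have [] := hmax _ (mul_ideal (2%:R : RR) hP).
- move=> x hx; have [h _ _ _] := hP; have [y hy] := toRTK (h _ hx).
  by exists y; [rewrite -hy | exists 0; rewrite mulr0 addr0].
- move=> /(_ _ (rval_inR (1 : RR))) [a ha [y /val_inj h]]; exfalso.
  apply: (@two_not_unit y); suff a0 : a = 0 by move: h; rewrite a0 add0r.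
  by apply/eqP; case: (eqVneq a 0) => // a0; case: hno; exists a.
- move=> h; exists 2%N => //; apply/h; exists 0; first by have [_ ] := hP.
  by exists 1; rewrite mulr1 add0r.
Qed.

Lemma red_mod m (x : RR) : (0 < m)%N ->
  exists c : {ffun 'I_d -> 'I_m}, exists y, x = lc hR (fun l => (c l : nat)%:Z) + m%:R * y.
Proof.
move=> m0.
have m0' : m%:Z != 0 by rewrite eqz_nat -lt0n.
have hl l : (absz (coef x l %% m)%Z < m)%N.
  by rewrite -ltz_nat abszE ger0_norm ?modz_ge0 // ltz_mod.
exists [ffun l => Ordinal (hl l)]; exists (lc hR (fun l => (coef x l %/ m)%Z)).
rewrite -{1}(lc_coef x) /lc mulr_sumr -big_split /=; apply: eq_bigr => l _.
rewrite ffunE /= abszE ger0_norm ?modz_ge0 // mulrzAr.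
rewrite {1}(divz_eq (coef x l) m) mulrzDr addrC; congr (_ + _).
by rewrite mulrC mulrzA -[_ *~ m]mulrzl.
Qed.

(** An ideal containing [m > 0] is determined by the classes modulo [m] that it contains. These are
    finite in number, so a proper ideal with the most classes is maximal. *)
Lemma exists_max_ideal I : is_ideal w I -> ~ I (rval (1 : RR)) ->
  exists2 P, is_max_ideal w P & forall x, I x -> P x.
Proof.
move=> hI I1.
(* A positive integer is needed in the ideal; if [I] has no nonzero element, it is replaced by
   [I + 2R]. *)
have [J [m [hJ [J1 [m0 [Jm IJ]]]]]] : exists J m, is_ideal w J /\ ~ J (rval (1 : RR)) /\
    (0 < m)%N /\ J (rval (m%:R : RR)) /\ (forall x, I x -> J x).
  have [[x [x0 hx]]|hno] := pselect (exists x : RR, x != 0 /\ I x).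
    by have [m m0 hm] := ideal_nat hI hx x0; exists I, m.
  exists (fun u => exists2 a : RR, I a & exists y : RR, u = rval (a + 2%:R * y)), 2%N.
  split; first exact: mul_ideal.
  split.
    move=> [a ha [y /val_inj h]]; apply: (@two_not_unit y); suff a0 : a = 0 by move: h; rewrite a0 add0r.
    by apply/eqP; case: (eqVneq a 0) => // a0; case: hno; exists a.
  split => //; split.
    exists 0; first by have [_ ] := hI.
    by exists 1; rewrite mulr1 add0r.
  move=> x hx; have [h _ _ _] := hI; have [y hy] := toRTK (h _ hx).
  by exists y; [rewrite -hy | exists 0; rewrite mulr0 addr0].
pose S (Q : K -> Prop) := [set c : {ffun 'I_d -> 'I_m} |
  decP (Q (rval (lc hR (fun l => (c l : nat)%:Z))))].
pose good t := decP (exists Q,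
  [/\ is_ideal w Q, ~ Q (rval (1 : RR)), forall x, J x -> Q x & #|S Q| = t]).
have exg : exists t, good t by exists #|S J|; apply/decPP; exists J.
have ubg t : good t -> (t <= #|{ffun 'I_d -> 'I_m}|)%N.
  by move=> /decPP[Q [_ _ _ <-]]; apply: max_card.
case: (ex_maxnP exg ubg) => t /decPP[Q [hQ Q1 JQ Qt]] tmax.
exists Q; last by move=> x /IJ /JQ.
split => //; first exact/proper_ideal1.
move=> Q' hQ' QQ'; have [Q'1|Q'1] := pselect (Q' (rval (1 : RR))).
  by left; move: Q'1; have [_ _ _ h] := hQ' => h1 x /h /(_ h1); rewrite mulr1.
right=> x; split; last exact: QQ'.
have sub : S Q \subset S Q'.
  by apply/subsetP => c; rewrite !inE => /decPP /QQ' ?; apply/decPP.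
have /eqP eqS : S Q == S Q'.
  rewrite eqEcard sub /= Qt; apply: tmax; apply/decPP; exists Q'; split => //.
  by move=> y /JQ /QQ'.
have [h _ _ _] := hQ' => hx; have [y hy] := toRTK (h _ hx); rewrite {}hy in hx *.
have [c [z hz]] := red_mod y m0.
have [_ qD qM qB] := ideal_RT hQ; have [_ q'D q'M q'B] := ideal_RT hQ'.
have mz : Q (rval (m%:R * z)) by rewrite mulrC; apply: qM; apply: JQ.
have : c \in S Q'.
  rewrite inE; apply/decPP.
  have -> : lc hR (fun l => (c l : nat)%:Z) = y - m%:R * z by rewrite hz addrK.
  by apply: q'B => //; apply: QQ'.
by rewrite -eqS inE => /decPP hc; rewrite hz; apply: qD.
Qed.

(** * The residue field of a maximal ideal, as a finite field *)

Section ResidueField.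
Variable P : K -> Prop.
Hypothesis hP : is_max_ideal w P.

Definition idpred of is_max_ideal w P : {pred RR} := fun x => decP (P (rval x)).

Lemma idpredP (x : RR) : reflect (P x) (x \in idpred hP).
Proof. exact: decPP. Qed.

Lemma idpred_idealr : idealr_closed (idpred hP).
Proof.
have [hI hp _] := hP; have [p0 pD pM _] := ideal_RT hI; split.
- exact/idpredP.
- by apply/idpredP; apply/(proper_ideal1 hI).
- by move=> a x y /idpredP hx /idpredP hy; apply/idpredP/pD => //; apply: pM.
Qed.

HB.instance Definition _ := isIdealr.Build RR (idpred hP) idpred_idealr.

Definition resQ := {ideal_quot (idpred hP)}.
HB.instance Definition _ := GRing.ComNzRing.on resQ.

Definition resQmap : RR -> resQ := \pi_{ideal_quot (idpred hP)}%qT.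
HB.instance Definition _ := GRing.RMorphism.copy resQmap (\pi_{ideal_quot (idpred hP)}%qT).

Lemma resQmap_eq0 x : resQmap x = 0 <-> P (rval x).
Proof.
rewrite -(rmorph0 resQmap); split.
  by move/eqP; rewrite -Quotient.idealrBE subr0 => /idpredP.
by move=> h; apply/eqP; rewrite -Quotient.idealrBE subr0; apply/idpredP.
Qed.

Lemma resQmap_surj y : exists x, resQmap x = y.
Proof. by exists (repr y); rewrite /resQmap reprK. Qed.

(** For [x] outside [P], maximality gives [1 = a + x z] with [a] in [P], so [z] represents the
    inverse. *)
Lemma resQ_inv_ex (y : resQ) : exists z, if y == 0 then z = 0 else z * y = 1.
Proof.
case: eqP => [_|/eqP y0]; first by exists 0.
have [x xy] := resQmap_surj y; have [hI hp hmax] := hP.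
have [] := hmax _ (mul_ideal x hI).
- move=> u hu; have [h _ _ _] := hI; have [v hv] := toRTK (h _ hu).
  by exists v; [rewrite -hv | exists 0; rewrite mulr0 addr0].
- move=> /(_ _ (rval_inR (1 : RR))) [a ha [z /val_inj h]]; exists (resQmap z).
  rewrite -xy -rmorphM mulrC -(rmorph1 resQmap) h rmorphD /=.
  by rewrite (resQmap_eq0 a).2 // add0r.
- move=> h; case/eqP: y0; rewrite -xy; apply/resQmap_eq0/h.
  exists 0; first by have [_ ] := hI.
  by exists 1; rewrite mulr1 add0r.
Qed.

Definition resQ_inv y := sval (cid (resQ_inv_ex y)).

Lemma resQ_mulVf y : y != 0 -> resQ_inv y * y = 1.
Proof. by move=> y0; rewrite /resQ_inv; case: cid => z /=; rewrite (negbTE y0). Qed.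

Lemma resQ_inv0 : resQ_inv 0 = 0.
Proof. by rewrite /resQ_inv; case: cid => z /=; rewrite eqxx. Qed.

HB.instance Definition _ := GRing.ComNzRing_isField.Build resQ resQ_mulVf resQ_inv0.

(** Some positive integer in [P], possibly different from the residue characteristic; reduction
    modulo it proves the quotient finite. *)
Definition maxnat := s2val (cid2 (max_ideal_nat hP)).

Lemma resQ_red (y : resQ) : exists c : {ffun 'I_d -> 'I_maxnat},
  resQmap (lc hR (fun l => (c l : nat)%:Z)) = y.
Proof.
rewrite /maxnat; case: cid2 => m m0 hm /=.
have [x xy] := resQmap_surj y; have [c [z hz]] := red_mod x m0; exists c.
rewrite -xy hz rmorphD /= rmorphM /= (resQmap_eq0 m%:R).2 // mul0r addr0 //.
Qed.

Definition resQ_rep y := sval (cid (resQ_red y)).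

Lemma resQ_repK : cancel resQ_rep (fun c => resQmap (lc hR (fun l => (c l : nat)%:Z))).
Proof. by move=> y; rewrite /resQ_rep; case: cid. Qed.

HB.instance Definition _ : isCountable resQ := CanIsCountable resQ_repK.
HB.instance Definition _ : isFinite resQ := CanIsFinite resQ_repK.

Definition resF : finFieldType := resQ.
Definition resmap : {rmorphism RR -> resF} := resQmap.

End ResidueField.
End MaximalIdeals.

(** * Counting *)

Section Counting.
Local Open Scope nat_scope.

(** Each [g] matches the fibre over [y] with the fibre over [y0] inside [A], so all fibres have
    equal size. It is applied with [g] a translation. *)
Lemma equidist (G H : finType) (f : G -> H) (y0 : H) (A : {set G}) (T : {set H}) :
  (forall y, exists2 g : G -> G, injective g &
     forall x, (f (g x) == y) = (f x == y0) /\ (g x \in A) = (x \in A)) ->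
  #|H| * #|[set x in A | f x \in T]| = #|T| * #|A|.
Proof.
move=> h; pose c := #|[set x in A | f x == y0]|.
have hc y : #|[set x in A | f x == y]| = c.
  have [g ig hg] := h y; rewrite /c -(card_preimset _ ig).
  by apply: eq_card => x; rewrite !inE; have [-> ->] := hg x.
have key (S : {set H}) : #|[set x in A | f x \in S]| = #|S| * c.
  rewrite -sum1_card (partition_big f (mem S)) => [|x]; last first.
    by rewrite inE => /andP[].
  rewrite -sum_nat_const; apply: eq_bigr => y yS; have {}yS : y \in S by [].
  rewrite -(hc y) -sum1_card.
  apply: eq_bigl => x; rewrite !inE; case: eqP => [->|_]; last by rewrite !andbF.
  by rewrite yS !andbT.
have := key setT; rewrite cardsT => e; rewrite key mulnCA -e.
by congr (_ * #|pred_of_set _|); apply/setP => x; rewrite !inE andbT.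
Qed.

Lemma card_row_free (F : finFieldType) n k : n <= k ->
  #|[set A : 'M[F]_(n, k) | row_free A]| = \prod_(i < n) (#|F| ^ k - #|F| ^ i).
Proof.
elim: n => [_ | n IHn /ltnW nk].
  rewrite big_ord0 (eq_card1 (x := 0%R)) // => A.
  by rewrite !inE /row_free [A]flatmx0 mxrank0 !eqxx.
rewrite big_ord_recr /= -IHn // -[n.+1]/(1 + n).
rewrite -[LHS]sum1_card.
rewrite (partition_big (dsubmx : 'M_(1 + n, k) -> 'M_(n, k))
  (mem [set A : 'M[F]_(n, k) | row_free A])) => [|A]; last first.
  rewrite !inE => /row_freeP[B AB]; apply/row_freeP.
  exists (rsubmx (B : 'M_(k, 1 + n))).
  rewrite -{1}(hsubmxK (B : 'M_(k, 1 + n))) -{1}(vsubmxK (A : 'M_(1 + n, k))) in AB.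
  rewrite mul_col_row (scalar_mx_block 1 n) in AB.
  by have [_ _ _] := eq_block_mx AB.
rewrite -sum_nat_const; apply: eq_bigr => A; rewrite 2!inE => fA.
rewrite (reindex (fun v : 'rV_k => col_mx v A)) /=; last first.
  exists usubmx => [v _ | B]; first by rewrite col_mxKu.
  by rewrite inE => /andP[_ /eqP <-]; rewrite vsubmxK.
(* The new top row must avoid the row span of [A], which has [q^n] elements because [A] is row
   free. *)
have <- : #|[set v *m A | v : 'rV[F]_n]%R| = #|F| ^ n.
  rewrite card_imset ?cardsT ?card_mx ?mul1n //.
  by have [B AB] := row_freeP fA; apply: can_inj (mulmx^~ B) _ => v; rewrite -mulmxA AB mulmx1.
have -> : #|F| ^ k = #|{: 'rV[F]_k}| by rewrite card_mx mul1n.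
rewrite -[X in _ = _ - #|pred_of_set X|]setCK -cardsCs -[RHS]sum1_card.
apply: eq_bigl => v.
rewrite !inE col_mxKd eqxx andbT.
have -> : (v \notin [set v *m A | v : 'rV[F]_n]%R) = ~~ (v <= A)%MS.
  by congr (~~ _); apply/imsetP/submxP => [[u _ ->]|[u ->]]; exists u.
rewrite /row_free -addsmxE; have rA := eqP fA.
case: (boolP (v <= A)%MS) => [/addsmx_idPr -> | vA]; rewrite /=.
  by rewrite rA -[n in n == _]add0n eqn_add2r.
have /rank_ltmx : (A < v + A)%MS.
  by rewrite ltmxE addsmxSr /=; apply: contra vA => /(submx_trans (addsmxSl _ _)).
rewrite rA => lt_n; rewrite eqn_leq lt_n andbT addsmxE.
exact: rank_leq_row.
Qed.

Lemma card_residue B m o a : a < m ->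
  B %/ m <= #|[set y : 'I_B | (y + o) %% m == a]| <= (B %/ m).+1.
Proof.
move=> am; have m0 : 0 < m by apply: leq_ltn_trans am.
have [r rm hr] : exists2 r, r < m & forall y, ((y + o) %% m == a) = (y %% m == r).
  exists ((a + (m - o %% m)) %% m); first exact: ltn_pmod.
  have oK : ((m - o %% m) + o) %% m = 0.
    by rewrite -modnDmr subnK ?modnn // ltnW // ltn_pmod.
  move=> y; apply/eqP/eqP => [<-|h].
    by rewrite modnDml -addnA (addnC o) -modnDmr oK addn0.
  by rewrite -modnDml h modnDml -addnA -modnDmr oK addn0 modn_small.
apply/andP; split.
  have hj (j : 'I_(B %/ m)) : j * m + r < B.
    rewrite (leq_trans _ (leq_trunc_div B m)) // -ltnS.
    by rewrite (@leq_trans (j.+1 * m).+1) // ?ltnS ?leq_mul2r ?ltn_ord ?orbT // mulSn addnC ltn_add2r.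
  rewrite -[leqLHS]card_ord -(card_imset _ (_ : injective (fun j => Ordinal (hj j)))).
    apply: subset_leq_card; apply/subsetP => _ /imsetP[j _ ->].
    by rewrite inE hr /= modnMDl modn_small.
  move=> i j [] /eqP; rewrite eqn_add2r eqn_pmul2r // => /eqP e; exact: val_inj.
rewrite -[leqRHS]card_ord.
have hd (y : 'I_B) : y %/ m < (B %/ m).+1 by rewrite ltnS leq_div2r // ltnW.
apply: (leq_card_in (fun y => Ordinal (hd y))) => y z.
rewrite !inE !hr => /eqP hy /eqP hz [] e; apply: val_inj => /=.
by rewrite (divn_eq y m) (divn_eq z m) e hy hz.
Qed.

Definition modff (I : finType) B m (m0 : 0 < m) o (x : {ffun I -> 'I_B}) : {ffun I -> 'I_m} :=
  [ffun i => Ordinal (ltn_pmod (x i + o) m0)].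

Lemma card_box (I : finType) B m (m0 : 0 < m) o (A : {set {ffun I -> 'I_m}}) :
  #|A| * (B %/ m) ^ #|I| <= #|[set x : {ffun I -> 'I_B} | modff m0 o x \in A]|
    <= #|A| * (B %/ m).+1 ^ #|I|.
Proof.
have -> : #|[set x : {ffun I -> 'I_B} | modff m0 o x \in A]|
    = \sum_(a in A) \prod_i #|[set y : 'I_B | (y + o) %% m == a i]|.
  rewrite -sum1_card (partition_big (modff m0 o) (mem A)) => [|x]; last by rewrite inE.
  apply: eq_bigr => a aA; rewrite sum1_card.
  transitivity #|family (fun i => [set y : 'I_B | (y + o) %% m == a i])|.
    apply: eq_card => x; rewrite !inE; apply/andP/familyP.
      by move=> [_ /eqP <-] i; rewrite inE ffunE.
    move=> h; suff e : modff m0 o x = a by rewrite inE e eqxx.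
    by apply/ffunP => i; rewrite ffunE; apply: val_inj => /=; have := h i; rewrite inE => /eqP.
  by rewrite card_family foldrE big_map big_enum.
rewrite -!sum_nat_const -!prod_nat_const; apply/andP; split; apply: leq_sum => a _;
  by apply: leq_prod => i _; case/andP: (card_residue B o (ltn_ord (a i))).
Qed.

(** Locked so that simplification does not expand the update. *)
Definition upd (I : finType) T (x : {ffun I -> T}) i0 t : {ffun I -> T} :=
  locked [ffun i => if i == i0 then t else x i].

Lemma updE (I : finType) T (x : {ffun I -> T}) i0 t i :
  upd x i0 t i = if i == i0 then t else x i.
Proof. by rewrite /upd -lock ffunE. Qed.

Lemma upd_same (I : finType) T (x : {ffun I -> T}) i0 t : upd x i0 t i0 = t.
Proof. by rewrite updE eqxx. Qed.

Lemma upd_other (I : finType) T (x : {ffun I -> T}) i0 t i : i != i0 -> upd x i0 t i = x i.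
Proof. by rewrite updE => /negbTE ->. Qed.

(** Lines in direction [i0] meet [E] in at most [m] points. Summing over all [x] counts each line
    [B] times, which gives the factor [B] on the left. *)
Lemma card_slice (I : finType) B (E : {set {ffun I -> 'I_B}}) i0 m :
  (forall x (s : seq 'I_B), uniq s -> (forall t, t \in s -> upd x i0 t \in E) -> size s <= m) ->
  #|E| * B <= m * B ^ #|I|.
Proof.
move=> h.
have hx (x : {ffun I -> 'I_B}) : \sum_(t < B) (upd x i0 t \in E) <= m.
  have -> : \sum_(t < B) (upd x i0 t \in E) = #|[set t | upd x i0 t \in E]|.
    by rewrite -sum1dep_card [RHS]big_mkcond; apply: eq_bigr => t _; case: (_ \in E).
  rewrite cardE; apply: (h x); first exact: enum_uniq.
  by move=> t; rewrite mem_enum inE.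
have -> : #|E| * B = \sum_(x : {ffun I -> 'I_B}) \sum_(t < B) (upd x i0 t \in E).
  rewrite pair_big /=.
  (* The involution exchanges the coordinate [x i0] with the free value [t]; after it the summand no
     longer depends on [t]. *)
  rewrite (reindex_inj (inv_inj (f := fun p : {ffun I -> 'I_B} * 'I_B => (upd p.1 i0 p.2, p.1 i0)) _)) /=.
    rewrite -(pair_big xpredT xpredT (fun x t => upd (upd x i0 t) i0 (x i0) \in E : nat)) /=.
    rewrite -sum1_card big_distrl /= big_mkcond /=; apply: eq_bigr => x _.
    have hu t : upd (upd x i0 t) i0 (x i0) = x.
      by apply/ffunP => i; rewrite !updE; case: eqP => [->|].
    under eq_bigr => t _ do rewrite hu.
    by rewrite sum_nat_const card_ord; case: (x \in E); rewrite ?mul1n ?muln1 ?muln0.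
  move=> [x t] /=; rewrite upd_same; congr pair.
  by apply/ffunP => i; rewrite !updE; case: eqP => [->|].
by rewrite -[X in X ^ _]card_ord -card_ffun mulnC -sum_nat_const; apply: leq_sum.
Qed.
End Counting.

(** * Local criterion for generation and the Chinese remainder theorem *)

Section Reductions.
Variables (K : fieldExtType rat) (d : nat) (w : d.-tuple K).
Hypothesis hR : is_order_with_basis w.
Notation RR := (RT hR).

Definition maxid := {P : K -> Prop | is_max_ideal w P}.
HB.instance Definition _ := gen_eqMixin maxid.
HB.instance Definition _ := gen_choiceMixin maxid.

Definition rF (M : maxid) : finFieldType := resF hR (proj2_sig M).
Definition phi (M : maxid) : {rmorphism RR -> rF M} := resmap hR (proj2_sig M).

Arguments rF : simpl never.
Arguments phi : simpl never.

Lemma phi_surj M y : exists x, phi M x = y.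
Proof. exact: resQmap_surj. Qed.

Lemma phi_eq0 M x : phi M x = 0 <-> sval M (rval x).
Proof. exact: resQmap_eq0. Qed.

Lemma maxid_eq (M N : maxid) : (forall x : RR, sval M (rval x) -> sval N (rval x)) -> M = N.
Proof.
move=> h; suff e : sval M = sval N.
  by case: M N e {h} => P hP [Q hQ] /= e; subst Q; congr exist; apply: Prop_irrelevance.
have [hM _ hmax] := proj2_sig M; have [hN hp _] := proj2_sig N.
have [m1 _ _ _] := hM.
case: (hmax _ hN) => [x hx|//|hs].
  by have [y hy] := toRTK hR (m1 _ hx); rewrite hy; apply: h; rewrite -hy.
by apply/funext => x; apply/propext; split => /hs.
Qed.

Lemma phi_sep (M N : maxid) : M != N -> exists x : RR, phi M x != 0 /\ phi N x = 0.
Proof.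
move=> MN; apply: contrapT => hno; case/eqP: MN; apply/esym/maxid_eq => x.
move=> /phi_eq0 hx; apply/phi_eq0/eqP/negP => /negP hM.
by apply: hno; exists x.
Qed.

(** A product of elements separating [M] from each member of [s] is nonzero at [M] and zero on [s];
    it is then rescaled in the residue field. *)
Lemma phi_crt (M : maxid) (s : seq maxid) : M \notin s -> forall y,
  exists x : RR, phi M x = y /\ forall N, N \in s -> phi N x = 0.
Proof.
move=> Ms y.
have [e [e0 he]] : exists e : RR, phi M e != 0 /\ forall N, N \in s -> phi N e = 0.
  elim: s Ms => [_|N s IH]; first by exists 1; rewrite rmorph1 oner_neq0.
  rewrite inE negb_or => /andP[/phi_sep[a [a0 aN]] /IH[b [b0 bs]]].
  exists (a * b); split; first by rewrite rmorphM mulf_neq0.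
  move=> N'; rewrite inE => /orP[/eqP->|/bs bN]; rewrite rmorphM /=.
    by rewrite aN mul0r.
  by rewrite bN mulr0.
have [z hz] := phi_surj ((phi M e)^-1 * y).
exists (z * e); split; first by rewrite rmorphM /= hz mulrAC mulVf ?mul1r.
by move=> N /he h; rewrite rmorphM /= h mulr0.
Qed.

Lemma phi_int (M : maxid) (m : nat) (z : int) (F := rF M) :
  phi M m%:R = 0 -> ((z %% m)%Z)%:~R = z%:~R :> F.
Proof.
rewrite rmorph_nat => h; rewrite [in RHS](divz_eq z m).
by rewrite [RHS]mulrzDr mulrC mulrzA -[(m%:Z)%:~R]/(m%:R) h mul0rz add0r.
Qed.

Lemma phi_lc M z : phi M (lc hR z) = \sum_l phi M (wR hR l) * (z l)%:~R.
Proof. by rewrite rmorph_sum; apply: eq_bigr => l _; rewrite rmorphMz /= mulrzr. Qed.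

(** The vectors are the columns, so generation means a right inverse, and full row rank locally. *)
Definition Amat n k (x : 'I_k * 'I_n * 'I_d -> int) : 'M[RR]_(n, k) :=
  \matrix_(i, j) lc hR (fun l => x (j, i, l)).

Lemma generates_right_inv n k (A : 'M[RR]_(n, k)) :
  generates w (fun j i => rval (A i j)) -> exists X, A *m X = 1%:M.
Proof.
move=> hg.
have hu i0 : exists a : 'I_k -> RR, forall i, \sum_j a j * A i j = (i == i0)%:R.
  have [|a [ha hs]] := hg (fun i => rval ((i == i0)%:R : RR)).
    by move=> i; apply: rval_inR.
  exists (fun j => toRT hR (ha j)) => i; apply: val_inj.
  by rewrite /= rval_sum -(hs i).
have [a ha] := choice hu; exists (\matrix_(j, i) a i j).
apply/matrixP => i i'; rewrite !mxE -(ha i' i).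
by apply: eq_bigr => j _; rewrite mxE mulrC.
Qed.

Lemma generatesP n k (A : 'M[RR]_(n, k)) :
  generates w (fun j i => rval (A i j)) <-> (forall M, row_free (map_mx (phi M) A)).
Proof.
split=> [/generates_right_inv[X hX] M | h].
  by apply/row_freeP; exists (map_mx (phi M) X); rewrite -map_mxM hX map_mx1.
pose J (x : K) := exists y : RR, x = rval y /\ exists X : 'M[RR]_(k, n), A *m X = y%:M.
have hJ : is_ideal w J.
  split.
  - by move=> _ [y [-> _]]; apply: rval_inR.
  - by exists 0; split => //; exists 0; rewrite mulmx0 raddf0.
  - move=> _ _ [y [-> [X hX]]] [z [-> [Y hY]]]; exists (y + z); split => //.
    by exists (X + Y); rewrite mulmxDr hX hY raddfD.
  - move=> _ _ /(toRTK hR)[r ->] [y [-> [X hX]]]; exists (r * y); split => //.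
    by exists (r *: X); rewrite -scalemxAr hX scale_scalar_mx.
have [[y [/val_inj <- [X hX]]]|J1] := pselect (J (rval (1 : RR))).
  move=> u hu; have [v hv] := choice (fun i => toRTK hR (hu i)).
  pose a := X *m (\col_i v i).
  exists (fun j => rval (a j 0)); split; first by move=> j; apply: rval_inR.
  move=> i; have /matrixP/(_ i 0) : A *m a = \col_i v i by rewrite mulmxA hX mul1mx.
  rewrite !mxE hv => <-; rewrite rval_sum; apply: eq_bigr => j _ /=.
  by rewrite mulrC.
have [P hP JP] := exists_max_ideal hJ J1.
pose M : maxid := exist _ P hP.
have /row_freeP[B hB] := h M.
have hb (p : 'I_k * 'I_n) : exists x, phi M x = B p.1 p.2 by apply: phi_surj.
have [b hb'] := choice hb.
pose B0 : 'M[RR]_(k, n) := \matrix_(i, j) b (i, j).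
have eB : map_mx (phi M) B0 = B by apply/matrixP => i j; rewrite !mxE hb'.
(* The adjugate puts this determinant in [J], hence in [M], although [A *m B0] reduces to the
   identity. *)
have : phi M (\det (A *m B0)) = 0.
  apply/phi_eq0/JP; exists (\det (A *m B0)); split => //.
  by exists (B0 *m \adj (A *m B0)); rewrite mulmxA mul_mx_adj.
by rewrite -det_map_mx map_mxM eB hB det1 => /eqP; rewrite oner_eq0.
Qed.

(** * Joint distribution of reductions modulo finitely many maximal ideals *)

Section Joint.
Variables (n k m' : nat).
Notation m := m'.+1.
Notation II := ('I_k * 'I_n * 'I_d)%type.
Variable T : forall M : maxid, {set 'M[rF M]_(n, k)}.

(** The modulus is a successor, so [x] ranges over an additive group; reduction is additive on it
    once [m] lies in [M]. *)
Definition redmat M (x : {ffun II -> 'I_m}) : 'M[rF M]_(n, k) :=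
  map_mx (phi M) (Amat (fun i => (x i : nat)%:Z)).

Lemma redmatD M x y : phi M m%:R = 0 -> redmat M (x + y) = redmat M x + redmat M y.
Proof.
move=> hm; apply/matrixP => i j; rewrite !mxE !phi_lc -big_split /=.
apply: eq_bigr => l _; rewrite -mulrDr -intrD -PoszD; congr (_ * _).
by rewrite ffunE /= -modz_nat phi_int.
Qed.

Lemma redmat_lift M s (y : 'M[rF M]_(n, k)) : M \notin s ->
  (forall N, N \in M :: s -> phi N m%:R = 0) ->
  exists g, redmat M g = y /\ forall N, N \in s -> redmat N g = 0.
Proof.
move=> Ms hm.
have hY (p : 'I_k * 'I_n) : exists c : {ffun 'I_d -> 'I_m},
    phi M (lc hR (fun l => (c l : nat)%:Z)) = y p.2 p.1 /\
    forall N, N \in s -> phi N (lc hR (fun l => (c l : nat)%:Z)) = 0.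
  have [x [xM xs]] := phi_crt Ms (y p.2 p.1).
  have [c [z hz]] := red_mod x (ltn0Sn m'); exists c.
  have hc N : N \in M :: s -> phi N (lc hR (fun l => (c l : nat)%:Z)) = phi N x.
    by move=> Ns; rewrite hz rmorphD rmorphM /= hm // mul0r addr0.
  rewrite hc ?mem_head //; split => // N Ns.
  by rewrite hc ?inE ?Ns ?orbT // xs.
have [c hc] := choice hY.
exists [ffun i => c i.1 i.2]; split => [|N Ns]; apply/matrixP => i j; rewrite !mxE.
  have [<- _] := hc (j, i); congr (phi M (lc hR _)); apply/funext => l.
  by rewrite ffunE.
have [_ /(_ _ Ns) <-] := hc (j, i); congr (phi N (lc hR _)); apply/funext => l.
by rewrite ffunE.
Qed.

(** Translating by an element from [redmat_lift] moves the reduction at [M] to any value and leaves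
    those on [s] unchanged, so the condition at [M] is independent of the others. *)
Lemma card_joint (s : seq maxid) : uniq s ->
  (forall M, M \in s -> phi M m%:R = 0) ->
  ((\prod_(M <- s) #|rF M| ^ (n * k)) * #|[set x | all (fun M => redmat M x \in T M) s]|
   = (\prod_(M <- s) #|T M|) * m ^ (k * n * d))%N.
Proof.
elim: s => [_ _|M s IH]; last rewrite cons_uniq => /andP[Ms us] hm.
  rewrite !big_nil !mul1n cardsT card_ffun card_ord; congr (_ ^ _)%N.
  by rewrite !card_prod !card_ord.
have hms N : N \in s -> phi N m%:R = 0 by move=> Ns; apply: hm; rewrite inE Ns orbT.
have key : (#|rF M| ^ (n * k) * #|[set x | all (fun M => redmat M x \in T M) (M :: s)]|
    = #|T M| * #|[set x | all (fun M => redmat M x \in T M) s]|)%N.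
  rewrite -card_mx -(@equidist _ _ (redmat M) 0); last first.
    move=> y; have [g [gM gs]] := redmat_lift y Ms hm.
    exists (fun x => x + g) => [|x]; first exact: addIr.
    rewrite redmatD ?hm ?mem_head // gM -[X in _ == X]add0r (inj_eq (addIr y)).
    split => //; rewrite !inE; apply: eq_in_all => N Ns.
    by rewrite redmatD ?hms // gs // addr0.
  by congr (_ * #|pred_of_set _|)%N; apply/setP => x; rewrite !inE andbC.
by rewrite !big_cons -mulnA -[RHS]mulnA -(IH us hms) mulnCA key mulnCA.
Qed.
End Joint.

(** [R/mR] has [m^d] elements and maps onto the product of the residue fields. In [card_joint] this
    is the case of [1 x 1] matrices and the sets [{0}], whose common preimage contains [0]. *)
Lemma prod_card_le (s : seq maxid) m : uniq s -> (0 < m)%N ->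
  (forall M, M \in s -> phi M m%:R = 0) -> (\prod_(M <- s) #|rF M| <= m ^ d)%N.
Proof.
case: m => // m us _ hm.
have := card_joint (n := 1) (k := 1) (fun M => [set 0]) us hm.
under eq_bigr do rewrite muln1 expn1.
under [in RHS]eq_bigr do rewrite cards1.
rewrite big1_eq !mul1n => <-; rewrite -[leqLHS]muln1 leq_mul2l; apply/orP; right.
apply/card_gt0P; exists 0; rewrite inE; apply/allP => M _.
rewrite inE; apply/eqP/matrixP => i j; rewrite !mxE phi_lc big1 // => l _.
by rewrite ffunE mulr0.
Qed.
End Reductions.

(** * Rank conditions in boxes *)

(** The Weierstrass product inequality; the induction also carries the signs of the sum and of the
    product. *)
Lemma prod_1B_ge (I : Type) (F : realFieldType) (r : seq I) (P : pred I) (x : I -> F) :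
  (forall i, P i -> 0 <= x i <= 1) ->
  1 - \sum_(i <- r | P i) x i <= \prod_(i <- r | P i) (1 - x i) <= 1.
Proof.
move=> h.
suff : [/\ 1 - \sum_(i <- r | P i) x i <= \prod_(i <- r | P i) (1 - x i),
   0 <= \sum_(i <- r | P i) x i, 0 <= \prod_(i <- r | P i) (1 - x i) & \prod_(i <- r | P i) (1 - x i) <= 1].
  by case=> -> _ _ ->.
elim/big_rec2: _ => [|i p s /h /andP[x0 x1] [h1 h2 h3 h4]]; first by split; rewrite ?subr0.
by split; nra.
Qed.

(** Each factor is [q^k (1 - q^-(k-i))], and [j = k - i] runs from [k-n+1] to [k]. *)
Lemma prod_row_free (F : realFieldType) (q n k : nat) : (0 < q)%N -> (n <= k)%N ->
  (\prod_(i < n) (q ^ k - q ^ i))%N%:R =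
  (q ^ (n * k))%N%:R * \prod_((k - n).+1 <= j < k.+1) (1 - (q%:R ^+ j)^-1) :> F.
Proof.
move=> q0; elim: n => [|n IH] nk.
  by rewrite big_ord0 mul0n expn0 subn0 big_geq // mulr1.
have q0' : (q%:R : F) != 0 by rewrite pnatr_eq0 -lt0n.
rewrite big_ord_recr /= natrM IH ?(ltnW nk) // subnSK // [in RHS]big_ltn ?ltnS ?leq_subr //.
rewrite mulSn expnD natrM natrB ?leq_pexp2l ?(ltnW nk) // !natrX.
have -> : (q%:R ^+ (k - n) : F) = q%:R ^+ k / q%:R ^+ n.
  by rewrite expfB_cond ?(negbTE q0') // ltnW.
have h1 : (q%:R ^+ k : F) != 0 by rewrite expf_neq0.
have h2 : (q%:R ^+ n : F) != 0 by rewrite expf_neq0.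
set X := \prod_(_ <= _ < _) _.
by field; rewrite h1 h2.
Qed.

Section Box.
Variables (K : fieldExtType rat) (d : nat) (w : d.-tuple K).
Hypothesis hR : is_order_with_basis w.
Notation RR := (RT hR).
Notation maxid := (maxid w).
Notation rF := (rF hR).
Notation phi := (phi hR).

Definition chr (M : maxid) : nat := s2val (finPcharP (rF M)).

Lemma chr_prime M : prime (chr M).
Proof. by rewrite /chr; case: finPcharP. Qed.

Lemma phi_nat_eq0 M m : (phi M m%:R = 0) <-> (chr M %| m)%N.
Proof.
rewrite /chr; case: finPcharP => p pp hp /=.
by rewrite rmorph_nat (dvdn_pcharf hp); split => /eqP.
Qed.

Lemma chr_le M : (chr M <= #|rF M|)%N.
Proof.
rewrite -[leqLHS]card_ord; apply: (leq_card (fun i : 'I_(chr M) => phi M (i : nat)%:R)).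
suff hle (i j : 'I_(chr M)) : (i <= j)%N -> phi M (i : nat)%:R = phi M (j : nat)%:R -> i = j.
  move=> i j h; case: (leqP i j) => [|/ltnW] ij; first exact: hle.
  exact/esym/hle.
move=> ij /eqP; rewrite eq_sym -subr_eq0 -rmorphB -natrB // => /eqP/phi_nat_eq0.
have := ltn_ord j => hj h; apply: val_inj => /=; apply/eqP; rewrite eqn_leq ij.
have [/eqP|pos] := posnP (j - i)%N; first by rewrite subn_eq0.
by have := dvdn_leq pos h; lia.
Qed.

Lemma chr_gt1 M : (1 < chr M)%N. Proof. exact/prime_gt1/chr_prime. Qed.

Variables (n k : nat).

Definition mat N (c : coeffs d N n k) : 'M[RR]_(n, k) :=
  Amat hR (fun i => (c i : nat)%:Z - N%:Z).

Lemma mat_vec_of N (c : coeffs d N n k) j i : rval (mat c i j) = vec_of w c j i.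
Proof. by rewrite mxE rval_lc. Qed.

(** Coefficients are centred at [N]; the shift [N * m'] is congruent to [-N] modulo [m'+1] and stays
    a natural number. *)
Lemma redmat_mod N (c : coeffs d N n k) m' M : phi M m'.+1%:R = 0 ->
  redmat hR M (modff (ltn0Sn m') (N * m')%N c) = map_mx (phi M) (mat c).
Proof.
move=> h; apply/matrixP => i j; rewrite !mxE !phi_lc; apply: eq_bigr => l _.
congr (_ * _); rewrite ffunE /= -modz_nat phi_int // PoszD PoszM.
have -> : (c (j, i, l) : int) + N%:Z * m' = (c (j, i, l) : int) - N%:Z + N%:Z * m'.+1 by lia.
by rewrite mulrzDr [N%:Z * _]mulrC mulrzA -[(m'.+1%:Z)%:~R]/(m'.+1%:R) -(rmorph_nat (phi M)) h mul0rz addr0.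
Qed.


(** [tau M] is the proportion of [T M] among all matrices. The joint proportion modulo [m'+1] is
    exact, and only the rounding of the box to whole periods separates the two bounds. *)
Lemma box_joint N m' (s : seq maxid) (T : forall M, {set 'M[rF M]_(n, k)}) (tau : maxid -> R)
    (g := #|[set c : coeffs d N n k | all (fun M => map_mx (phi M) (mat c) \in T M) s]|) :
  uniq s -> (forall M, M \in s -> phi M m'.+1%:R = 0) ->
  (forall M, #|T M|%:R = (#|rF M| ^ (n * k))%:R * tau M) ->
  (\prod_(M <- s) tau M) * (m'.+1 * ((2 * N).+1 %/ m'.+1))%:R ^+ (k * n * d) <= g%:R
   <= (\prod_(M <- s) tau M) * (m'.+1 * ((2 * N).+1 %/ m'.+1).+1)%:R ^+ (k * n * d).
Proof.
move=> us hs hT.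
have := congr1 (fun x : nat => x%:R : R) (card_joint T us hs).
cbv beta; set E := [set x | _].
rewrite !natrM !natr_prod.
under [X in X * _ = _]eq_bigr do rewrite natrX.
under [X in _ = X * _]eq_bigr do rewrite hT natrX.
rewrite big_split /= -mulrA natrX.
have hQ : \prod_(M <- s) (#|rF M|%:R ^+ (n * k)) != 0 :> R.
  rewrite prodf_seq_neq0; apply/allP => M _; rewrite expf_neq0 // pnatr_eq0 -lt0n.
  by apply/card_gt0P; exists 0.
move=> /(mulfI hQ) hE.
have -> : g = #|[set c : coeffs d N n k | modff (ltn0Sn m') (N * m') c \in E]|.
  apply: eq_card => c; rewrite !inE; apply: eq_in_all => M Ms.
  by rewrite redmat_mod // hs.
have /andP[h1 h2] := card_box (2 * N).+1 (ltn0Sn m') (N * m') E.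
have cI : #|{: 'I_k * 'I_n * 'I_d}| = (k * n * d)%N by rewrite !card_prod !card_ord.
by rewrite !exprMn !mulrA -hE -!natrX -!natrM !ler_nat -cI h1 h2.
Qed.

(** For [n <= k], both the proportion of matrices of full row rank over the residue field and the
    local factor at [M] of the limit. *)
Definition delta (M : maxid) : R :=
  \prod_((k - n).+1 <= j < k.+1) (1 - (#|rF M|%:R ^+ j)^-1).

Lemma card_rF_gt1 M : (1 < #|rF M|)%N.
Proof. exact: leq_trans (chr_gt1 M) (chr_le M). Qed.

Lemma inv_card_bound M j : 0 <= (#|rF M|%:R ^+ j : R)^-1 <= 1.
Proof.
rewrite invr_ge0 exprn_ge0 //= invf_le1 ?exprn_gt0 ?ltr0n ?(ltnW (card_rF_gt1 M)) //.
by rewrite exprn_ege1 // ler1n ltnW ?card_rF_gt1.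
Qed.

Definition ok N (c : coeffs d N n k) M := row_free (map_mx (phi M) (mat c)).

Lemma row_free_delta M : (n <= k)%N ->
  #|[set A : 'M[rF M]_(n, k) | row_free A]|%:R = (#|rF M| ^ (n * k))%:R * delta M.
Proof. by move=> nk; rewrite card_row_free // prod_row_free // (ltnW (card_rF_gt1 M)). Qed.

Lemma box_ok N m' (s : seq maxid) : (n <= k)%N -> uniq s ->
  (forall M, M \in s -> phi M m'.+1%:R = 0) ->
  (\prod_(M <- s) delta M) * (m'.+1 * ((2 * N).+1 %/ m'.+1))%:R ^+ (k * n * d)
   <= #|[set c : coeffs d N n k | all (ok c) s]|%:R
   <= (\prod_(M <- s) delta M) * (m'.+1 * ((2 * N).+1 %/ m'.+1).+1)%:R ^+ (k * n * d).
Proof.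
move=> nk us hs.
have := box_joint N us hs (fun M => row_free_delta M nk).
suff -> : [set c : coeffs d N n k | all (fun M => map_mx (phi M) (mat c) \in [set A | row_free A]) s]
  = [set c : coeffs d N n k | all (ok c) s] by [].
by apply/setP => c; rewrite !inE; apply: eq_all => M; rewrite inE.
Qed.

(** For [n < k] all [n] exponents are at least 2, which makes the failures summable over [M]. *)
Lemma delta_ge M : (n < k)%N -> 1 - n%:R / #|rF M|%:R ^+ 2 <= delta M.
Proof.
move=> nk; rewrite /delta.
have /andP[+ _] := @prod_1B_ge nat R (index_iota (k - n).+1 k.+1) xpredT
  (fun j => (#|rF M|%:R ^+ j)^-1) (fun j _ => inv_card_bound M j).
apply: le_trans; rewrite lerD2l lerN2.
apply: (@le_trans _ _ (\sum_((k - n).+1 <= j < k.+1) (#|rF M|%:R ^+ 2)^-1)).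
  rewrite [leLHS]big_nat [leRHS]big_nat; apply: ler_sum => j /andP[hj _].
  rewrite lef_pV2 ?posrE ?exprn_gt0 ?ltr0n ?(ltnW (card_rF_gt1 M)) //.
  by rewrite ler_weXn2l ?ler1n ?(ltnW (card_rF_gt1 M)) //; lia.
rewrite sumr_const_nat -[leLHS]mulr_natl; apply: ler_wpM2r; first by rewrite invr_ge0 exprn_ge0.
by rewrite ler_nat; lia.
Qed.

(** The factor 2 is the price of rounding: [p (B/p + 1) <= B + p <= 2B] for [p = chr M <= B]. *)
Lemma card_fail N M : (n < k)%N -> (chr M <= (2 * N).+1)%N ->
  #|[set c : coeffs d N n k | ~~ ok c M]|%:R <=
    n%:R / #|rF M|%:R ^+ 2 * (2 * (2 * N).+1)%:R ^+ (k * n * d) :> R.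
Proof.
move=> nk hM; have pc := prime_gt0 (chr_prime M).
have hs N' : N' \in [:: M] -> phi N' (chr M).-1.+1%:R = 0.
  by rewrite inE prednK // => /eqP ->; apply/phi_nat_eq0.
have hT M' : #|~: [set A : 'M[rF M']_(n, k) | row_free A]|%:R =
    (#|rF M'| ^ (n * k))%:R * (1 - delta M').
  rewrite mulrBr mulr1 -row_free_delta ?(ltnW nk) // -[X in X - _](_ : #|{: 'M[rF M']_(n, k)}|%:R = _).
    by rewrite -(cardsC [set A | row_free A]) natrD addrC addKr.
  by rewrite card_mx.
have /andP[_] := box_joint N (isT : uniq [:: M]) hs hT.
have -> : [set c : coeffs d N n k | all (fun M' => map_mx (phi M') (mat c) \in ~: [set A | row_free A]) [:: M]]
    = [set c : coeffs d N n k | ~~ ok c M].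
  by apply/setP => c; rewrite !inE /= !inE andbT.
rewrite big_seq1 => h; apply: le_trans h _; rewrite prednK //.
have := delta_ge M nk => hd.
have h1 : 0 <= 1 - delta M.
  rewrite subr_ge0 /delta.
  by have /andP[] := @prod_1B_ge nat R (index_iota (k - n).+1 k.+1) xpredT
  (fun j => (#|rF M|%:R ^+ j)^-1) (fun j _ => inv_card_bound M j).
apply: ler_pM => //; [by rewrite exprn_ge0 | by rewrite lerBlDl -lerBlDr | ].
rewrite lerXn2r ?nnegrE // ler_nat mulnS [leqRHS]mulSn mul1n.
by rewrite leq_add // mulnC leq_trunc_div.
Qed.
End Box.

(** * Maximal ideals of large residue characteristic *)

Section Dependence.
Variable F : fieldType.
Implicit Types (a : nat -> nat -> F) (t s : nat).

(** Dependence of the first [t] rows on the first [s] columns; indexing by [nat] lets [t] and [s]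
    vary without casts between matrix types. *)
Definition dep t s a := exists2 u : nat -> F, exists2 i, (i < t)%N & u i != 0 &
  forall j, (j < s)%N -> \sum_(i < t) u i * a i j = 0.

Lemma dep_le t s s' a : (s' <= s)%N -> dep t s a -> dep t s' a.
Proof. by move=> h [u u0 hu]; exists u => // j hj; apply/hu/(leq_trans hj). Qed.

(** Independence of the first [t] rows forces a nonzero coefficient on row [t], by which the
    relation is divided. *)
Lemma dep_normal t s a : ~ dep t s a -> dep t.+1 s.+1 a ->
  exists u : nat -> F, forall j, (j < s.+1)%N -> \sum_(i < t) u i * a i j = - a t j.
Proof.
move=> nd [u [i it ui] hu]; have ut : u t != 0.
  apply/negP => /eqP ut; apply: nd; exists u.
    exists i => //; move: it; rewrite ltnS leq_eqVlt => /orP[/eqP e|//].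
    by rewrite e ut eqxx in ui.
  move=> j js; have := hu j (ltnW js).
  by rewrite big_ord_recr /= ut mul0r addr0.
exists (fun i => u i / u t) => j js; have := hu j js.
rewrite big_ord_recr /= => /eqP; rewrite addr_eq0 => /eqP h.
under eq_bigr do rewrite mulrAC; rewrite -mulr_suml h.
by rewrite mulNr mulrAC divff // mul1r.
Qed.

(* The entry in the corner is determined by the others: the first [s] columns fix the
   combination of the first [t] rows that gives row [t]. *)
Lemma dep_corner t s a a' : ~ dep t s a ->
  (forall i j, (i <= t)%N -> (j <= s)%N -> ~~ ((i == t) && (j == s)) -> a i j = a' i j) ->
  dep t.+1 s.+1 a -> dep t.+1 s.+1 a' -> a t s = a' t s.
Proof.
move=> nd e da da'; have nd' : ~ dep t s a'.
  move=> [u u0 hu]; apply: nd; exists u => // j js; rewrite -[RHS](hu j js).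
  apply: eq_bigr => i _; rewrite e ?(ltnW (ltn_ord i)) ?(ltnW js) //.
  by rewrite ltn_eqF.
have [u hu] := dep_normal nd da; have [u' hu'] := dep_normal nd' da'.
have uE i : (i < t)%N -> u i = u' i.
  move=> it; apply/eqP; rewrite -subr_eq0; apply/negP => /negP ne; apply: nd.
  exists (fun i => u i - u' i); first by exists i.
  move=> j js; under eq_bigr do rewrite mulrBl; rewrite sumrB hu ?ltnS ?(ltnW js) //.
  have -> : \sum_(i < t) u' i * a i j = \sum_(i < t) u' i * a' i j.
    apply: eq_bigr => i' _; rewrite e ?(ltnW (ltn_ord i')) ?(ltnW js) //.
    by rewrite ltn_eqF.
  rewrite hu' ?ltnS ?(ltnW js) // e ?(ltnW js) ?subrr //.
  by rewrite eqxx /= ltn_eqF.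
apply/oppr_inj; rewrite -hu // -hu' //; apply: eq_bigr => i _.
by rewrite uE // e ?(ltnW (ltn_ord i)) // ltn_eqF.
Qed.

Lemma dep0 s a : ~ dep 0 s a.
Proof. by case=> u []. Qed.

Lemma det0_dep t (A : 'M[F]_t) a : (forall i j : 'I_t, A i j = a i j) ->
  (\det A = 0) <-> dep t t a.
Proof.
move=> hA; split=> [/eqP/det0P[v v0 hv]|[u [i it ui] hu]].
  have [i vi] : exists i, v 0 i != 0.
    by apply/existsP; apply: contraR v0 => /existsPn h; apply/eqP/rowP => i;
      rewrite mxE; apply/eqP; have := h i; rewrite negbK.
  exists (fun i => if insub i is Some i' then v 0 i' else 0).
    by exists i => //; rewrite valK.
  move=> j js; have /matrixP/(_ 0 (Ordinal js)) := hv; rewrite !mxE => h0; rewrite -[RHS]h0.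
  by apply: eq_bigr => i' _; rewrite valK hA.
apply/eqP/det0P; exists (\row_i u i).
  by apply/negP => /eqP/rowP/(_ (Ordinal it)); rewrite !mxE => /eqP; apply/negP.
apply/rowP => j; rewrite !mxE -[RHS](hu j (ltn_ord j)).
by apply: eq_bigr => i' _; rewrite mxE hA.
Qed.

Lemma not_row_free_dep n k (A : 'M[F]_(n, k)) a : (forall i j, A i j = a i j) ->
  ~~ row_free A -> dep n k a.
Proof.
move=> hA; rewrite -kermx_eq0 => /rowV0Pn[v /sub_kermxP hv v0].
have [i vi] : exists i, v 0 i != 0.
  by apply/existsP; apply: contraR v0 => /existsPn h; apply/eqP/rowP => i;
    rewrite mxE; apply/eqP; have := h i; rewrite negbK.
exists (fun i => if insub i is Some i' then v 0 i' else 0).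
  by exists i => //; rewrite valK.
move=> j js; have /matrixP/(_ 0 (Ordinal js)) := hv; rewrite !mxE => h0; rewrite -[RHS]h0.
by apply: eq_bigr => i' _; rewrite valK hA.
Qed.
End Dependence.

(** * Rank failures at characteristics beyond the box size *)

Section Tail.
Variables (K : fieldExtType rat) (d : nat) (w : d.-tuple K).
Hypothesis hR : is_order_with_basis w.
Notation RR := (RT hR).
Notation maxid := (maxid w).
Notation rF := (rF hR).
Notation phi := (phi hR).
Notation chr := (chr hR).
Variables (n k : nat).
Notation D := (k * n * d)%N.
Notation Bx N := (2 * N).+1.
Notation coeffs N := (coeffs d N n k).

Definition ent N (c : coeffs N) (i j : nat) : RR :=
  if (insub i : option 'I_n) is Some i' then
    if (insub j : option 'I_k) is Some j' then mat hR c i' j' else 0 else 0.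

Lemma entE N (c : coeffs N) (i : 'I_n) (j : 'I_k) : ent c i j = mat hR c i j.
Proof. by rewrite /ent !valK. Qed.

Lemma ent_upd N (c : coeffs N) (s : 'I_k) (t : 'I_n) l v (i j : nat) :
  ~~ ((i == t) && (j == s)) -> ent (upd c (s, t, l) v : coeffs N) i j = ent c i j.
Proof.
rewrite /ent; case: insubP => // i' _ <-; case: insubP => // j' _ <- h.
rewrite !mxE; congr lc; apply/funext => l'; rewrite upd_other //.
by rewrite !xpair_eqE negb_and [X in ~~ X]andbC h.
Qed.

Lemma mat_sub N (c c' : coeffs N) i j : mat hR c i j - mat hR c' i j =
  lc hR (fun l => (c (j, i, l) : nat)%:Z - (c' (j, i, l) : nat)%:Z).
Proof.
rewrite !mxE /lc -sumrB; apply: eq_bigr => l _; rewrite -mulrzBr; congr (_ *~ _).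
by rewrite opprB addrA subrK.
Qed.

Lemma mat_upd N (c : coeffs N) (s : 'I_k) (t : 'I_n) l v v' :
  mat hR (upd c (s, t, l) v : coeffs N) t s - mat hR (upd c (s, t, l) v' : coeffs N) t s
  = wR hR l *~ ((v : nat)%:Z - (v' : nat)%:Z).
Proof.
rewrite mat_sub /lc (bigD1 l) // big1 => [|l' ll].
  by rewrite /= addr0 !upd_same.
have ne : (s, t, l') != (s, t, l) by rewrite xpair_eqE (negbTE ll) andbF.
by rewrite !(upd_other _ _ ne) subrr.
Qed.

Lemma bnd_ent N (c : coeffs N) i j : bnd (ent c i j) N.
Proof.
rewrite /ent; case: insubP => [i' _ _|_]; last by move=> l; rewrite coef0 normr0.
case: insubP => [j' _ _|_]; last by move=> l; rewrite coef0 normr0.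
move=> l; rewrite mxE coef_lc ler_norml.
have := ltn_ord (c (j', i', l)).
set z := nat_of_ord _; move: z => z hz; apply/andP; split; lia.
Qed.

Definition blk t N (c : coeffs N) : 'M[RR]_t := \matrix_(i, j) ent c i j.

Lemma eq_blk t N (c c' : coeffs N) :
  (forall i j : 'I_t, ent c i j = ent c' i j) -> blk t c = blk t c'.
Proof. by move=> h; apply/matrixP => i j; rewrite [LHS]mxE [RHS]mxE. Qed.

Definition sing t N (c : coeffs N) := dep t t (fun i j => rval (ent c i j)).

Lemma singP t N (c : coeffs N) : sing t c <-> \det (blk t c) = 0.
Proof.
rewrite /sing -(@det0_dep _ _ (map_mx (val : RR -> K) (blk t c))); last first.
  by move=> i j; rewrite !mxE.
rewrite det_map_mx; split => [h|->]; last by rewrite rmorph0.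
by apply: val_inj; rewrite h.
Qed.

Lemma dep_phi_det M t N (c : coeffs N) : dep t t (fun i j => phi M (ent c i j)) ->
  phi M (\det (blk t c)) = 0.
Proof.
rewrite -det_map_mx => h; apply/(@det0_dep _ _ _ _ _).2/h => i j.
by rewrite !mxE.
Qed.

Lemma wR_mulz_eq0 l z : wR hR l *~ z = 0 -> z = 0.
Proof. by move=> /(congr1 (fun x => coef x l)); rewrite coef0 coefMz wR_lc coef_lc eqxx mul1r. Qed.

Let cardI : #|{: 'I_k * 'I_n * 'I_d}| = D.
Proof. by rewrite !card_prod !card_ord. Qed.

(** If the leading block of order [t] is nonsingular, at most one value of the entry [(t,t)] makes
    the next block singular. Each order thus adds one point per line. *)
Lemma card_sing N t : (t <= n)%N -> (t <= k)%N ->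
  (#|[set c : coeffs N | decP (sing t c)]| * Bx N <= t * Bx N ^ D)%N.
Proof.
elim: t => [|t IH] tn tk.
  rewrite (_ : [set c | _] = set0) ?cards0 //; apply/setP => c; rewrite !inE.
  by apply/decPP; apply: dep0.
pose E := [set c : coeffs N | decP (sing t.+1 c /\ ~ sing t c)].
have hE : (#|E| * Bx N <= 1 * Bx N ^ D)%N.
  rewrite -cardI; apply: (@card_slice _ _ _ (Ordinal tk, Ordinal tn, Ordinal (d_gt0 hR))).
  move=> x [|v [|v' s]] //= /andP[+ _]; rewrite inE negb_or => /andP[/eqP vv' _] hs.
  exfalso; apply: vv'.
  have := hs v (mem_head _ _); rewrite inE => /decPP[hv1 hv2].
  have := hs v'; rewrite !inE eqxx orbT => /(_ isT)/decPP[hv1' _].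
  have := dep_corner hv2 _ hv1 hv1'.
  rewrite (entE _ (Ordinal tn) (Ordinal tk)) (entE _ (Ordinal tn) (Ordinal tk)) => hc.
  pose i0 := (Ordinal tk, Ordinal tn, Ordinal (d_gt0 hR)).
  have /val_inj/eqP :
      rval (mat hR (upd x i0 v : coeffs N) (Ordinal tn) (Ordinal tk))
      = rval (mat hR (upd x i0 v' : coeffs N) (Ordinal tn) (Ordinal tk)).
    by apply: hc => i j _ _ h; rewrite !(@ent_upd _ _ (Ordinal tk) (Ordinal tn)).
  rewrite -subr_eq0 mat_upd => /eqP/wR_mulz_eq0 h.
  by apply: val_inj => /=; lia.
rewrite [(t.+1 * _)%N]mulSn [(_ + t * _)%N]addnC -[X in (_ <= _ + X)%N]mul1n.
apply: leq_trans (leq_add (IH (ltnW tn) (ltnW tk)) hE).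
rewrite -mulnDl leq_mul2r; apply/orP; right.
apply: leq_trans (leq_card_setU _ _); apply/subset_leq_card/subsetP => c.
rewrite !inE => /decPP h; apply/orP.
have [hs|hs] := pselect (sing t c); first by left; apply/decPP.
by right; apply/decPP.
Qed.

Lemma phi_int_eq0 M (z : int) : z%:~R = 0 :> rF M -> (chr M %| absz z)%N.
Proof.
move=> h; apply/phi_nat_eq0; rewrite rmorph_nat; case: z h => m //=.
by rewrite NegzE mulrNz => /eqP; rewrite oppr_eq0 => /eqP.
Qed.

Lemma phi_norm M x : phi M x = 0 -> phi M (absz (nm x))%:R = 0.
Proof.
by move=> h; have [y ->] := absz_nm_dvd x; rewrite rmorphM h mulr0.
Qed.

(** Here [t+1] is the first order at which dependence modulo [M] sets in. As [w_l] is outside [M],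
    the residue of an entry with its other coefficients fixed determines coefficient [l] modulo
    [chr M], hence exactly, the box being shorter. *)
Definition slab t l N := [set c : coeffs N | decP (~ sing t.+1 c /\ exists M,
  [/\ (Bx N < chr M)%N, phi M (wR hR l) != 0, ~ dep t t.+1 (fun i j => phi M (ent c i j)) &
      dep t.+1 t.+2 (fun i j => phi M (ent c i j))])].

(* Only boundedly many maximal ideals of residue characteristic exceeding the box size
   contain the nonzero determinant, whose norm is polynomial in the box size; each of them
   leaves at most one value for the corner coordinate. *)
Lemma card_slab t : (t < n)%N -> (t.+1 < k)%N ->
  exists C B0, forall l N, (B0 <= Bx N)%N -> (#|slab t l N| * Bx N <= C * Bx N ^ D)%N.
Proof.
move=> tn tk; have [C [e hC]] := nm_det_bnd hR t.+1.
(* [B >= C+2] absorbs the constant: the norm of the minor is at most [B^(e+1)]. The distinct ideals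
   have index above [B] and product of indices at most [B^((e+1)d)], so there are at most [(e+1)d]
   of them. *)
exists (e.+1 * d)%N, C.+2 => l N hB; rewrite -cardI.
set i0 := (Ordinal tk, Ordinal tn, l).
apply: (@card_slice _ _ _ i0) => x s us hs.
case: s us hs => [//|v0 s0]; set s := v0 :: s0 => us hs.
have [c cU] : exists c : 'I_(Bx N) -> coeffs N, forall v, c v = upd x i0 v by exists (upd x i0).
have cE v v' i j : ~~ ((i == t) && (j == t.+1)) -> ent (c v) i j = ent (c v') i j.
  by move=> h; rewrite !cU !(@ent_upd _ _ (Ordinal tk) (Ordinal tn)).
have hs' v : v \in s -> ~ sing t.+1 (c v) /\ exists M,
  [/\ (Bx N < chr M)%N, phi M (wR hR l) != 0, ~ dep t t.+1 (fun i j => phi M (ent (c v) i j)) &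
      dep t.+1 t.+2 (fun i j => phi M (ent (c v) i j))].
  by move=> vs; have := hs v vs; rewrite -cU inE => /decPP.
have [ns0 [M0 _]] := hs' v0 (mem_head _ _).
have hex v : exists M, v \in s ->
  [/\ (Bx N < chr M)%N, phi M (wR hR l) != 0,
      ~ dep t t.+1 (fun i j => phi M (ent (c v) i j)) &
      dep t.+1 t.+2 (fun i j => phi M (ent (c v) i j))].
  by case: (boolP (v \in s)) => [/hs'[_ [M hM]]|_]; [exists M | exists M0].
have [f hf] := choice hex.
have inj : {in s &, injective f}.
  move=> v v' vs vs' ff; have [h1 h2 h3 h4] := hf v vs.
  have [_ _ _ h4'] := hf v' vs'; rewrite -ff in h4'.
  have hc := dep_corner h3 _ h4 h4'.
  have : phi (f v) (ent (c v) t t.+1) = phi (f v) (ent (c v') t t.+1).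
    by apply: hc => i j _ _ h; rewrite (cE v v').
  rewrite !(entE _ (Ordinal tn) (Ordinal tk)) => /eqP.
  rewrite -subr_eq0 -rmorphB !cU mat_upd rmorphMz /= -mulrzr mulf_eq0 (negbTE h2) /=.
  move=> /eqP/phi_int_eq0 hz; apply: val_inj => /=.
  have hv := ltn_ord v; have hv' := ltn_ord v'.
  have [z0|z0] := posnP (absz ((v : nat)%:Z - (v' : nat)%:Z)); first lia.
  by have := dvdn_leq z0 hz; lia.
pose D0 := \det (blk t.+1 (c v0)).
have D0_neq0 : D0 != 0 by apply/eqP => /singP.
have phiD v : v \in s -> phi (f v) D0 = 0.
  move=> vs; have [_ _ _ h] := hf v vs.
  (* The varied entry is in column [t+1], outside the leading block, so one determinant serves the
     whole line. *)
  have eb : blk t.+1 (c v0) = blk t.+1 (c v).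
    by apply: eq_blk => i j; apply: cE; rewrite negb_and (ltn_eqF (ltn_ord j)) orbT.
  by rewrite /D0 eb; apply: dep_phi_det; apply: dep_le h.
have m_gt0 : (0 < absz (nm D0))%N by rewrite absz_gt0 nm_neq0.
have := @prod_card_le _ _ _ hR (map f s) _ _ m_gt0.
rewrite (map_inj_in_uniq inj) => /(_ us) hp.
have {}hp : (\prod_(M <- map f s) #|rF M| <= absz (nm D0) ^ d)%N.
  by apply: hp => _ /mapP[v vs ->]; apply/phi_norm/phiD.
have hpow (r : seq 'I_(Bx N)) : {subset r <= s} ->
    (Bx N ^ size r <= \prod_(M <- map f r) #|rF M|)%N.
  elim: r => [|v r IH] hr; first by rewrite big_nil.
  rewrite big_cons expnS leq_mul //.
    have [h _ _ _] := hf v (hr v (mem_head _ _)).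
    exact: leq_trans (ltnW h) (chr_le hR _).
  by apply: IH => v' h; apply: hr; rewrite inE h orbT.
have hnm : (absz (nm D0) <= Bx N ^ e.+1)%N.
  apply: leq_trans (hC _ N _) _; first by move=> i j; rewrite mxE; apply: bnd_ent.
  rewrite expnS leq_mul //; first lia.
  by case: (e) => // e'; rewrite leq_exp2r //; lia.
have hd : (absz (nm D0) ^ d <= Bx N ^ (e.+1 * d))%N.
  by rewrite expnM leq_exp2r ?(d_gt0 hR).
have := leq_trans (hpow s (fun _ h => h)) (leq_trans hp hd).
by rewrite leq_exp2l //; lia.
Qed.

Definition large t N := [set c : coeffs N | decP (exists M,
  (Bx N < chr M)%N /\ dep t t.+1 (fun i j => phi M (ent c i j)))].

(** Either the first [t] rows were already dependent modulo [M], or the leading block of order [t+1]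
    is singular over [K], or some [slab] contains the point. Column [t+1] exists because of the
    strict bound by [k]. *)
Lemma card_large t : (t <= n)%N -> (t < k)%N ->
  exists C B0, forall N, (B0 <= Bx N)%N -> (#|large t N| * Bx N <= C * Bx N ^ D)%N.
Proof.
elim: t => [|t IH] tn tk.
  exists 0%N, 0%N => N _; rewrite (_ : large 0 N = set0) ?cards0 //.
  apply/setP => c; rewrite !inE; apply/decPP => -[M [_ h]].
  exact: dep0 h.
have [C1 [B1 h1]] := IH (ltnW tn) (ltnW tk).
have [C2 [B2 h2]] := card_slab tn tk.
exists (C1 + (t.+1 + d * C2))%N, (B1 + B2)%N => N hB.
have {}h1 := h1 N (leq_trans (leq_addr _ _) hB).
have {}h2 l := h2 l N (leq_trans (leq_addl _ _) hB).
have h3 := card_sing N tn (ltnW tk).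
have h4 : ((\sum_l #|slab t l N|) * Bx N <= d * C2 * Bx N ^ D)%N.
  rewrite -mulnA -[X in (_ <= X * _)%N]card_ord -sum_nat_const big_distrl /=.
  exact: leq_sum.
rewrite !mulnDl; apply: leq_trans (leq_add h1 (leq_add h3 h4)).
rewrite -!mulnDl leq_mul2r; apply/orP; right.
have hU : (#|\bigcup_l slab t l N| <= \sum_l #|slab t l N|)%N.
  by apply: (big_ind2 (fun (A : {set coeffs N}) m => #|A| <= m)%N) => [|A a B b hA hb|//];
    rewrite ?cards0 // (leq_trans (leq_card_setU _ _)) // leq_add.
apply: leq_trans (leq_add (leqnn _) (leq_trans (leq_card_setU _ _) (leq_add (leqnn _) hU))).
apply: leq_trans (leq_card_setU _ _); apply/subset_leq_card/subsetP => c.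
rewrite !inE => /decPP[M [hM hd]].
have [hl|hl] := pselect (dep t t.+1 (fun i j => phi M (ent c i j))).
  by apply/orP; left; apply/decPP; exists M.
apply/orP; right; apply/orP.
have [hs|hs] := pselect (sing t.+1 c); first by left; apply/decPP.
(* Otherwise [1], a combination of the basis, would lie in [M]. *)
right; have [l hw] : exists l, phi M (wR hR l) != 0.
  apply: contrapT => hno; have : phi M 1 = 0.
    rewrite -[1]lc_coef phi_lc big1 // => l _.
    have -> : phi M (wR hR l) = 0; last by rewrite mul0r.
    by apply/eqP/negP => /negP hl0; apply: hno; exists l.
  by rewrite rmorph1 => /eqP; rewrite oner_eq0.
apply/bigcupP; exists l => //; rewrite inE; apply/decPP; split => //.
by exists M.
Qed.

Lemma not_ok_dep N (c : coeffs N) M t : (t <= k)%N -> ~~ ok hR c M ->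
  dep n t (fun i j => phi M (ent c i j)).
Proof.
move=> tk h; apply: dep_le tk _; apply: not_row_free_dep h => i j.
by rewrite mxE entE.
Qed.

Lemma card_large_fail : (n < k)%N -> exists C B0, forall N, (B0 <= Bx N)%N ->
  (#|[set c : coeffs N | decP (exists M, (Bx N < chr M)%N /\ ~~ ok hR c M)]| * Bx N
    <= C * Bx N ^ D)%N.
Proof.
move=> nk; have [C [B0 h]] := card_large (leqnn n) nk.
exists C, B0 => N /h; apply: leq_trans; rewrite leq_mul2r; apply/orP; right.
apply/subset_leq_card/subsetP => c; rewrite !inE => /decPP[M [hM hok]].
by apply/decPP; exists M; split => //; apply: not_ok_dep.
Qed.
End Tail.

(** * Square matrices *)

(** The cofactors of the last row do not involve that row, so only the corner term changes. *)
Lemma det_corner (T : comNzRingType) n (A A' : 'M[T]_n.+1) :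
  (forall i j, ~~ ((i == ord_max) && (j == ord_max)) -> A i j = A' i j) ->
  \det A = \det A' +
    (A ord_max ord_max - A' ord_max ord_max) * \det (row' ord_max (col' ord_max A')).
Proof.
move=> h; rewrite (expand_det_row _ ord_max) [\det A'](expand_det_row _ ord_max).
have hcof j : cofactor A ord_max j = cofactor A' ord_max j.
  rewrite /cofactor; congr (_ * \det _); apply/matrixP => i i'; rewrite [LHS]mxE [RHS]mxE.
  by rewrite [LHS]mxE [RHS]mxE h // eq_sym (negbTE (neq_lift _ _)).
have c1 : cofactor A' ord_max ord_max = \det (row' ord_max (col' ord_max A')).
  by rewrite /cofactor addnn -signr_odd odd_double mul1r.
rewrite (bigD1 ord_max) //= [in RHS](bigD1 ord_max) //= -c1 hcof mulrBl.
rewrite [RHS]addrC addrA addrNK; congr (_ + _); apply: eq_bigr => j jm.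
by rewrite hcof h // negb_and jm orbT.
Qed.

Section Square.
Variables (K : fieldExtType rat) (d : nat) (w : d.-tuple K).
Hypothesis hR : is_order_with_basis w.
Notation RR := (RT hR).
Variables (n : nat).
Notation coeffs N := (coeffs d N n.+1 n.+1).
Notation Bx N := (2 * N).+1.

Lemma vec_of_mat N m k (c : Defs.coeffs d N m k) :
  vec_of w c = (fun j i => rval (mat hR c i j)).
Proof. by apply/funext => j; apply/funext => i; rewrite mat_vec_of. Qed.

Lemma minor_blk N (c : coeffs N) :
  row' ord_max (col' ord_max (mat hR c)) = blk hR n c.
Proof.
apply/matrixP => i j; rewrite [LHS]mxE [LHS]mxE [RHS]mxE -entE.
by rewrite !lift_max.
Qed.

(** [n] accounts for a singular leading block of order [n]. Off that set the determinant is affine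
    in the varied coordinate with nonzero slope, and [nm_line_unit] contributes [2 * d]. *)
Lemma card_gen_square N :
  (gen_count w n.+1 n.+1 N * Bx N <= (n + 2 * d) * Bx N ^ (n.+1 * n.+1 * d))%N.
Proof.
have cardI : #|{: 'I_n.+1 * 'I_n.+1 * 'I_d}| = (n.+1 * n.+1 * d)%N.
  by rewrite !card_prod !card_ord.
pose E := [set c : coeffs N | decP (generates w (vec_of w c) /\ ~ sing hR n c)].
have hE : (#|E| * Bx N <= 2 * d * Bx N ^ (n.+1 * n.+1 * d))%N.
  rewrite -cardI; pose l := Ordinal (d_gt0 hR).
  apply: (@card_slice _ _ _ (ord_max, ord_max, l)) => x s us hs.
  case: s us hs => [//|v0 s0]; set s := v0 :: s0 => us hs.
  have [c cU] : exists c : 'I_(Bx N) -> coeffs N, forall v, c v = upd x (ord_max, ord_max, l) v.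
    by exists (upd x (ord_max, ord_max, l)).
  have hs' v : v \in s -> generates w (vec_of w (c v)) /\ ~ sing hR n (c v).
    by move=> vs; have := hs v vs; rewrite -cU inE => /decPP.
  have [_ ns0] := hs' v0 (mem_head _ _).
  pose b := wR hR l * \det (blk hR n (c v0)).
  have b0 : b != 0.
    apply/eqP => /(congr1 (@rval _ _ _ hR)) /eqP; rewrite /b /= mulf_eq0 => /orP[] /eqP h.
      by have /eqP := wR_neq0 hR l; apply; apply: val_inj; exact: h.
    by apply/ns0/singP/val_inj.
  have hdet v : \det (mat hR (c v)) = \det (mat hR (c v0)) + b *~ ((v : nat)%:Z - (v0 : nat)%:Z).
    rewrite (@det_corner _ _ _ (mat hR (c v0))) => [|i j h].
      by rewrite minor_blk !cU mat_upd -cU mulrzAl.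
    by rewrite -!entE !cU !(@ent_upd _ _ _ hR _ _ _ _ ord_max ord_max).
  rewrite -(size_map (fun v : 'I_(Bx N) => (v : nat)%:Z - (v0 : nat)%:Z)).
  apply: (nm_line_unit (a := \det (mat hR (c v0))) b0).
    by rewrite map_inj_uniq // => v v' h; apply: val_inj => /=; lia.
  move=> _ /mapP[v vs ->]; rewrite -hdet.
  have [+ _] := hs' v vs; rewrite (vec_of_mat (c v)) => /generates_right_inv[X hX].
  apply: (@nm_unit _ _ _ _ _ (\det X)).
  by rewrite -det_mulmx hX det1.
rewrite mulnDl; apply: leq_trans (leq_add (card_sing hR N (leqnSn n) (leqnSn n)) hE).
rewrite -mulnDl leq_mul2r; apply/orP; right.
apply: leq_trans (leq_card_setU _ _); apply/subset_leq_card/subsetP => c.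
rewrite !inE => /decPP h; apply/orP.
have [hs|hs] := pselect (sing hR n c); first by left; apply/decPP.
by right; apply/decPP.
Qed.
End Square.

(** * Limits *)

Lemma Un_cvP (f : nat -> R) (l : R) :
  Un_cv f l <-> forall e : R, 0 < e -> exists N0, forall N, (N0 <= N)%N -> `|f N - l| < e.
Proof.
split=> h e /RltP/h[N0 hN]; exists N0 => N.
  by move=> /ssrnat.leP/hN/RltP; rewrite RdistE.
by move=> /ssrnat.leP/hN ?; apply/RltP; rewrite RdistE.
Qed.

Lemma small_div (A e : R) : 0 <= A -> 0 < e -> exists2 X : nat, (0 < X)%N & A / X%:R < e.
Proof.
move=> A0 e0; have /andP[_ h] := truncn_itv (divr_ge0 A0 (ltW e0)).
set X := (Num.truncn (A / e)).+1 in h; exists X => //.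
by rewrite ltr_pdivrMr ?ltr0n // mulrC -ltr_pdivrMr.
Qed.

Lemma le_of_div (A c e : R) : 0 <= A ->
  (forall X : nat, (0 < X)%N -> c <= e + A / X%:R) -> c <= e.
Proof.
move=> A0 h; rewrite leNgt; apply/negP => ec.
have ce : 0 < c - e by rewrite subr_gt0.
have [X X0 hX] := small_div A0 ce.
by have := h X X0; rewrite leNgt -ltrBrDl hX.
Qed.

(** [A] is uniform in [X], whereas [C] and [B0] may depend on it: [X] is fixed first, then [N]
    grows. *)
Lemma Un_cv_of_bounds (f : nat -> R) (l A : R) : 0 <= A ->
  (forall X, (0 < X)%N -> exists C B0, 0 <= C /\
     forall N, (B0 <= (2 * N).+1)%N -> `|f N - l| <= A / X%:R + C / (2 * N).+1%:R) ->
  Un_cv f l.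
Proof.
move=> A0 h; apply/Un_cvP => e e0.
have e2 : 0 < e / 2 by rewrite divr_gt0.
have [X X0 hX] := small_div A0 e2.
have [C [B0 [C0 hC]]] := h X X0.
have [Y Y0 hY] := small_div C0 e2.
exists (B0 + Y)%N => N hN; apply: le_lt_trans (hC N _) _; first by lia.
rewrite [e]splitr ltrD // (le_lt_trans _ hY) // ler_wpM2l //.
by rewrite lef_pV2 ?posrE ?ltr0n // ler_nat; lia.
Qed.

Lemma prod_diff_le (I : eqType) (r : seq I) (a b : I -> R) :
  (forall i, i \in r -> 0 <= a i <= 1) -> (forall i, i \in r -> 0 <= b i <= 1) ->
  `|\prod_(i <- r) a i - \prod_(i <- r) b i| <= \sum_(i <- r) `|a i - b i|.
Proof.
elim: r => [|i r IH] ha hb; first by rewrite !big_nil subrr normr0.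
have ha' j : j \in r -> 0 <= a j <= 1 by move=> h; apply: ha; rewrite inE h orbT.
have hb' j : j \in r -> 0 <= b j <= 1 by move=> h; apply: hb; rewrite inE h orbT.
rewrite !big_cons; set p := \prod_(j <- r) a j; set q := \prod_(j <- r) b j.
have -> : a i * p - b i * q = (a i - b i) * p + b i * (p - q) by ring.
have /andP[b0 b1] := hb i (mem_head _ _).
have p0 : 0 <= p <= 1.
  rewrite /p big_seq; elim/big_ind: _ => [|x y /andP[x0 x1] /andP[y0 y1]|j /ha'//].
    by rewrite ler01 lexx.
  by rewrite mulr_ge0 // mulr_ile1.
have /andP[p0' p1] := p0.
apply: le_trans (ler_normD _ _) _; rewrite !normrM; apply: lerD.
  by rewrite ler_piMr // ger0_norm.
apply: le_trans (IH ha' hb'); rewrite (ger0_norm b0).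
by rewrite -[leRHS]mul1r ler_wpM2r.
Qed.

(** * Euler products *)

Section EulerProducts.
Variables (K : fieldExtType rat) (d : nat) (w : d.-tuple K).
Hypothesis hR : is_order_with_basis w.
Notation maxid := (maxid w).
Notation rF := (rF hR).
Notation phi := (phi hR).
Notation chr := (chr hR).

Definition nrm (M : maxid) : nat := #|rF M|.

Lemma size_le_of_nat (s : seq maxid) m : uniq s -> (0 < m)%N ->
  (forall M, M \in s -> (chr M %| m)%N) -> (2 ^ size s <= m ^ d)%N.
Proof.
move=> us m0 hs; apply: leq_trans (prod_card_le us m0 (hR := hR) _); last first.
  by move=> M /hs h; apply/phi_nat_eq0.
elim: s {us hs} => [|M s IH]; first by rewrite big_nil.
by rewrite big_cons expnS leq_mul // card_rF_gt1.
Qed.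

(** All these ideals contain [X!], which bounds the length of a list of distinct ones; a longest
    list is complete. *)
Lemma complete_list X : exists s : seq maxid, uniq s /\ forall M, (M \in s) = (chr M <= X)%N.
Proof.
pose good t := decP (exists s : seq maxid,
  [/\ uniq s, forall M, M \in s -> (chr M <= X)%N & size s = t]).
have exg : exists t, good t by exists 0%N; apply/decPP; exists [::].
have ubg t : good t -> (t <= (X`!) ^ d)%N.
  move=> /decPP[s [us hs <-]].
  apply: leq_trans (ltnW (ltn_expl _ (ltnSn 1))) (size_le_of_nat us (fact_gt0 X) _).
  by move=> M /hs h; apply: dvdn_fact; rewrite h (ltnW (chr_gt1 hR M)).
case: (ex_maxnP exg ubg) => t /decPP[s [us hs st]] tmax.
exists s; split => // M; apply/idP/idP => [/hs//|hM]; apply: contraT => Ms.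
have /tmax : good t.+1; last by rewrite ltnn.
apply/decPP; exists (M :: s); split; rewrite /= ?Ms ?st // => M'.
by rewrite inE => /orP[/eqP->|/hs].
Qed.

(** Each index is at least [p], while their product is at most [p^d]. *)
Lemma count_chr (s : seq maxid) p : prime p -> uniq s -> (forall M, M \in s -> chr M = p) ->
  (size s <= d)%N.
Proof.
move=> pp us hs; rewrite -(leq_exp2l _ _ (prime_gt1 pp)).
apply: leq_trans (prod_card_le us (prime_gt0 pp) (hR := hR) _); last first.
  by move=> M /hs h; apply/phi_nat_eq0; rewrite h.
elim: s {us} hs => [|M s IH] hs; first by rewrite big_nil.
rewrite big_cons expnS leq_mul //; first by rewrite -(hs M (mem_head _ _)) chr_le.
by apply: IH => M' h; apply: hs; rewrite inE h orbT.
Qed.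

(* At most [d] maximal ideals lie over each prime, so the sum is dominated by
   [d] times the telescoping sum of [1 / (p - 1) - 1 / p]. *)
Lemma tail_sum X (s : seq maxid) : (0 < X)%N -> uniq s ->
  (forall M, M \in s -> (X < chr M)%N) ->
  \sum_(M <- s) ((nrm M)%:R ^+ 2)^-1 <= d%:R / X%:R :> R.
Proof.
move=> X0 us hs.
have h1 : \sum_(M <- s) ((nrm M)%:R ^+ 2)^-1 <= \sum_(M <- s) ((chr M)%:R ^+ 2)^-1 :> R.
  apply: ler_sum => M _.
  rewrite lef_pV2 ?posrE ?exprn_gt0 ?ltr0n ?(ltnW (card_rF_gt1 hR M)) ?(ltnW (chr_gt1 hR M)) //.
  by rewrite lerXn2r ?nnegrE // ler_nat chr_le.
apply: le_trans h1 _.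
suff key t (r : seq maxid) : uniq r -> (forall M, M \in r -> (X < chr M <= X + t)%N) ->
    \sum_(M <- r) ((chr M)%:R ^+ 2)^-1 <= d%:R * (X%:R^-1 - (X + t)%:R^-1) :> R.
  (* Any bound for the characteristics in [s] would do; it closes the window for the induction. *)
  pose Y := (\sum_(M <- s) chr M)%N.
  apply: le_trans (key Y s us _) _.
    move=> M Ms; rewrite hs //= /Y (big_rem M) //=; apply: leq_trans (leq_addl X _).
    exact: leq_addr.
  by rewrite ler_wpM2l // gerBl invr_ge0.
elim: t r => [|t IH] r ur hr.
  case: r ur hr => [|M r] ur hr; first by rewrite big_nil addn0 subrr mulr0.
  by have := hr M (mem_head _ _); rewrite addn0; case: ltnP.
rewrite (bigID (fun M => chr M == (X + t.+1)%N)) /= -big_filter -[X in _ + X]big_filter.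
set r1 := filter _ r; set r2 := filter _ r.
have hr2 : \sum_(M <- r2) ((chr M)%:R ^+ 2)^-1 <= d%:R * (X%:R^-1 - (X + t)%:R^-1) :> R.
  apply: IH; first exact: filter_uniq.
  move=> M; rewrite mem_filter => /andP[hne /hr/andP[-> hle]] /=.
  by rewrite -ltnS -addnS ltn_neqAle hne.
have hr1 : \sum_(M <- r1) ((chr M)%:R ^+ 2)^-1 <= d%:R * ((X + t.+1)%:R ^+ 2)^-1 :> R.
  have -> : \sum_(M <- r1) ((chr M)%:R ^+ 2)^-1 = \sum_(M <- r1) ((X + t.+1)%:R ^+ 2)^-1 :> R.
    by apply: eq_big_seq => M; rewrite mem_filter => /andP[/eqP ->].
  rewrite big_const_seq count_predT iter_addr addr0 -[leLHS]mulr_natl.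
  rewrite ler_wpM2r ?invr_ge0 ?exprn_ge0 // ler_nat.
  case e : r1 => [//|M r1']; rewrite -e.
  have : M \in r1 by rewrite e mem_head.
  rewrite mem_filter => /andP[/eqP hM _].
  apply: (@count_chr _ (chr M)); [exact: chr_prime | exact: filter_uniq |].
  by move=> M'; rewrite mem_filter hM => /andP[/eqP].
apply: le_trans (lerD hr1 hr2) _; rewrite -mulrDr ler_wpM2l // addrC.
have x0 : 0 < (X + t)%:R :> R by rewrite ltr0n addn_gt0 X0.
rewrite addnS -natr1; set x : R := (X + t)%:R in x0 *; move: x x0 => x x0.
rewrite -addrA lerD2l.
have -> : - x^-1 + ((x + 1) ^+ 2)^-1 = - (x + 1)^-1 - (x * (x + 1) ^+ 2)^-1.
  have nx : x != 0 by apply: lt0r_neq0.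
  have nx1 : x + 1 != 0 by apply: lt0r_neq0; rewrite addr_gt0.
  by field; rewrite nx nx1.
by rewrite gerBl invr_ge0 mulr_ge0 ?exprn_ge0 ?addr_ge0 ?(ltW x0).
Qed.

Definition euler (j : nat) (s : seq maxid) : R :=
  \prod_(M <- s) (1 - ((nrm M)%:R ^+ j)^-1).

Lemma euler_bounds j s : 0 <= euler j s <= 1.
Proof.
rewrite /euler; elim/big_ind: _ => [|x y /andP[x0 x1] /andP[y0 y1]|M _].
- by rewrite ler01 lexx.
- by rewrite mulr_ge0 // mulr_ile1.
- by have /andP[h0 h1] := inv_card_bound hR M j; rewrite subr_ge0 h1 gerBl.
Qed.

(** Beyond [s0] the list [s] is arbitrary, so this gives both the Cauchy property and convergence
    along all finite sets in [is_zeta_inv]. *)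
Lemma euler_close j X s0 s : (1 < j)%N -> (0 < X)%N -> uniq s0 -> uniq s ->
  (forall M, (M \in s0) = (chr M <= X)%N) -> {subset s0 <= s} ->
  `|euler j s - euler j s0| <= d%:R / X%:R.
Proof.
move=> j1 X0 us0 us hs0 sub.
pose r := [seq M <- s | M \notin s0].
have hp : perm_eq s (s0 ++ r).
  apply: uniq_perm => //.
    rewrite cat_uniq us0 filter_uniq // andbT; apply/hasPn => M.
    by rewrite mem_filter => /andP[].
  move=> M; rewrite mem_cat mem_filter; case: (boolP (M \in s0)) => [/sub ->|] //=.
have -> : euler j s = euler j s0 * euler j r.
  by rewrite /euler (perm_big _ hp) big_cat.
have /andP[e0 e1] := euler_bounds j s0; have /andP[r0 r1] := euler_bounds j r.
have hr : 1 - euler j r <= d%:R / X%:R.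
  have /andP[h _] := @prod_1B_ge _ R r xpredT
    (fun M => ((nrm M)%:R ^+ j)^-1) (fun M _ => inv_card_bound hR M j).
  apply: le_trans (_ : \sum_(M <- r) ((nrm M)%:R ^+ 2)^-1 <= _); last first.
    apply: tail_sum => //; first exact: filter_uniq.
    by move=> M; rewrite mem_filter hs0 -ltnNge => /andP[].
  rewrite lerBlDr -lerBlDl; apply: le_trans h; rewrite lerD2l lerN2.
  apply: ler_sum => M _; rewrite lef_pV2 ?posrE ?exprn_gt0 ?ltr0n ?(ltnW (card_rF_gt1 hR M)) //.
  by rewrite ler_weXn2l // ler1n (ltnW (card_rF_gt1 hR M)).
rewrite -[X in _ - X]mulr1 -mulrBr normrM (ger0_norm e0) distrC ger0_norm ?subr_ge0 //.
by apply: le_trans hr; rewrite ler_piMl // subr_ge0.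
Qed.

(** Ordered by residue characteristic rather than by index, so that [X!] lies in every member and
    serves as common modulus. *)
Definition maxids X := sval (cid (complete_list X)).

Lemma maxids_uniq X : uniq (maxids X).
Proof. by rewrite /maxids; case: cid => s []. Qed.

Lemma mem_maxids X M : (M \in maxids X) = (chr M <= X)%N.
Proof. by rewrite /maxids; case: cid => s []. Qed.

Lemma maxids_sub X Y : (X <= Y)%N -> {subset maxids X <= maxids Y}.
Proof. by move=> h M; rewrite !mem_maxids => /leq_trans; apply. Qed.

Lemma euler_lim j : (1 < j)%N ->
  exists z, 0 <= z <= 1 /\ forall X, (0 < X)%N -> `|euler j (maxids X) - z| <= d%:R / X%:R.
Proof.
move=> j1.
have hclose X Y : (0 < X)%N -> (X <= Y)%N ->
    `|euler j (maxids Y) - euler j (maxids X)| <= d%:R / X%:R.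
  move=> X0 XY; apply: euler_close => //; try exact: maxids_uniq.
    exact: mem_maxids.
  exact: maxids_sub.
have [z hz] : {z | Un_cv (fun X => euler j (maxids X)) z}.
  apply: R_complete => e /RltP e0.
  have e2 : 0 < e / 2 by rewrite divr_gt0.
  have [X X0 hX] := small_div (ler0n _ d) e2; exists X => n m.
  move=> /ssrnat.leP hn /ssrnat.leP hm; apply/RltP; rewrite RdistE.
  apply: le_lt_trans (ler_distD (euler j (maxids X)) _ _) _.
  rewrite [e]splitr; apply: ltrD; first exact: le_lt_trans (hclose _ _ X0 hn) hX.
  by rewrite distrC; apply: le_lt_trans (hclose _ _ X0 hm) hX.
have h X : (0 < X)%N -> `|euler j (maxids X) - z| <= d%:R / X%:R.
  move=> X0; rewrite leNgt; apply/negP; rewrite -subr_gt0 => e0.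
  have [N0 hN] := (Un_cvP _ _).1 hz _ e0.
  have := hN (maxn N0 X) (leq_maxl _ _).
  have := hclose X (maxn N0 X) X0 (leq_maxr _ _); rewrite distrC.
  set a := euler j _; set b := euler j _ => h1 h2.
  have := ler_distD b a z; lra.
exists z; split => //; apply/andP; split.
  rewrite -oppr_le0; apply: (le_of_div (ler0n _ d)) => X X0; rewrite add0r.
  apply: le_trans (h X X0); apply: le_trans (ler_norm _).
  by have /andP[e0 _] := euler_bounds j (maxids X); lra.
apply: (le_of_div (ler0n _ d)) => X X0.
have := h X X0; rewrite distrC => h1; have := le_trans (ler_norm _) h1.
by have /andP[_ e1] := euler_bounds j (maxids X); lra.
Qed.

Lemma ideal_indexP (M : maxid) q : ideal_index w (sval M) q <-> q = nrm M.
Proof.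
have key : ideal_index w (sval M) q -> q = nrm M.
  move=> [r [h1 h2 h3]].
  have hi i j : phi M (toRT hR (h1 i)) = phi M (toRT hR (h1 j)) -> i = j.
    move=> /eqP; rewrite -subr_eq0 -rmorphB => /eqP/phi_eq0 h; apply/eqP.
    by apply: contraT => /h2; case.
  have hs y : exists i, phi M (toRT hR (h1 i)) = y.
    have [x <-] := phi_surj y; have [i hi'] := h3 _ (rval_inR x); exists i.
    apply/esym/eqP; rewrite -subr_eq0 -rmorphB; apply/eqP/phi_eq0; exact: hi'.
  have [g hg] := choice hs.
  apply/eqP; rewrite eqn_leq -[q]card_ord; apply/andP; split.
    by apply: (leq_card (fun i => phi M (toRT hR (h1 i)))) => i j; apply: hi.
  by apply: (leq_card g) => y y' e; rewrite -(hg y) e hg.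
split=> [//|->].
have [g hg] := choice (fun i : 'I_(nrm M) => @phi_surj _ _ _ hR M (enum_val i)).
exists (fun i => rval (g i)); split => [i|i j ij /= h|x /(toRTK hR)[y ->]].
- exact: rval_inR.
- case/eqP: ij; apply/enum_val_inj; rewrite -!hg; apply/eqP.
  by rewrite -subr_eq0 -rmorphB; apply/eqP/phi_eq0.
- exists (enum_rank (phi M y)).
  have : phi M (y - g (enum_rank (phi M y))) = 0 by rewrite rmorphB hg enum_rankK subrr.
  by move/phi_eq0.
Qed.

Lemma euler_prodE j (L : list ((K -> Prop) * nat)) :
  (forall pq, List.In pq L -> is_max_ideal w pq.1 /\ ideal_index w pq.1 pq.2) ->
  exists s : seq maxid, [/\ euler_prod j L = euler j s,
    forall M, M \in s <-> exists pq, List.In pq L /\ pq.1 = sval M &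
    List.ForallOrdPairs (fun a b => ~ same_ideal a.1 b.1) L -> uniq s].
Proof.
elim: L => [|[P q] L IH] hL.
  exists [::]; split => //; first by rewrite /euler big_nil.
  by move=> M; split => // -[pq []].
have [s [he hm hu]] := IH (fun pq h => hL pq (or_intror h)).
have [hP hq] := hL (P, q) (or_introl erefl).
pose M : maxid := exist _ P hP; exists (M :: s); split.
- rewrite /euler big_cons -/(euler j s) -he /= -((ideal_indexP M q).1 hq).
  by rewrite RpowE INRE.
- move=> M'; rewrite inE; split => [/orP[/eqP->|/hm[pq [h1 h2]]]|[pq [[<-|h] /= h2]]].
  + by exists (P, q); split => //; left.
  + by exists pq; split => //; right.
  + by apply/orP; left; apply/eqP/(maxid_eq (hR := hR)) => x; rewrite -h2.
  + by apply/orP; right; apply/hm; exists pq.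
- move=> hF; inversion hF as [|a l h1 h2]; subst; rewrite cons_uniq hu // andbT.
  apply/negP => /hm[pq [hin e]]; move/List.Forall_forall: h1 => /(_ _ hin); apply.
  by move=> x; rewrite e.
Qed.

Lemma is_zeta_inv_of_lim j z : (1 < j)%N ->
  (forall X, (0 < X)%N -> `|euler j (maxids X) - z| <= d%:R / X%:R) -> is_zeta_inv w j z.
Proof.
move=> j1 hz; rewrite /is_zeta_inv; case: eqP => [e|_ eps /RltP eps0]; first by rewrite e in j1.
have e2 : 0 < eps / 2 by rewrite divr_gt0.
have [X X0 hX] := small_div (ler0n _ d) e2.
(* This threshold is at least every index in [maxids X], so a list complete up to it contains them
   all. *)
exists (\sum_(M <- maxids X) nrm M)%N => L hL hD hC.
have [s [-> hm /(_ hD) us]] := euler_prodE j hL.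
apply/RltP; rewrite RabsE RminusE.
apply: le_lt_trans (ler_distD (euler j (maxids X)) _ _) _.
rewrite [eps]splitr; apply: ltrD; last exact: le_lt_trans (hz X X0) hX.
apply: le_lt_trans hX; apply: euler_close => //; first exact: maxids_uniq.
  exact: mem_maxids.
move=> M hM; apply/hm.
have [|pq [h1 h2]] := hC (sval M) (nrm M) (proj2_sig M) ((ideal_indexP M _).2 erefl).
  by rewrite (big_rem M) //= leq_addr.
exists pq; split => //; apply/funext => x; apply/propext; exact: h2.
Qed.
End EulerProducts.

(** * The density *)

(** The chord of the convex power function over [[0, 1]]. *)
Lemma expr1D_le (F : realFieldType) (y : F) e : 0 <= y <= 1 ->
  (1 + y) ^+ e <= 1 + (2 ^+ e - 1) * y.
Proof.
move=> /andP[y0 y1]; elim: e => [|e IH]; first by rewrite !expr0 subrr mul0r addr0.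
rewrite !exprS; have h : 1 <= 2 ^+ e :> F by rewrite exprn_ege1 // ler1n.
move: (2 ^+ e) ((1 + y) ^+ e) h IH => a b h IH.
apply: le_trans (_ : (1 + y) * (1 + (a - 1) * y) <= _).
  by rewrite ler_wpM2l // addr_ge0.
have hh : 0 <= (a - 1) * (y * (1 - y)) by rewrite !mulr_ge0 ?subr_ge0.
by rewrite -subr_ge0; apply: le_trans hh _; rewrite le_eqVlt; apply/orP; left; apply/eqP; ring.
Qed.

Lemma expr1B_ge (F : realFieldType) (y : F) e : 0 <= y <= 1 ->
  1 - e%:R * y <= (1 - y) ^+ e.
Proof.
move=> hy; have /andP[h _] := @prod_1B_ge _ F (index_iota 0 e) xpredT (fun=> y) (fun _ _ => hy).
move: h; rewrite sumr_const_nat prodr_const_nat subn0.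
by rewrite -[y *+ e]mulr_natl.
Qed.

Lemma two_sided_bound (F : realFieldType) (a q e p y : F) : 0 <= a <= 1 -> 0 <= y ->
  1 <= p -> 0 <= e -> a * (1 - e * y) <= q -> q <= a * (1 + (p - 1) * y) ->
  `|q - a| <= (e + p) * y.
Proof.
move=> /andP[a0 a1] y0 p1 e0 l u.
have e1 : a * (e * y) <= e * y by rewrite ler_piMl // mulr_ge0.
have e2 : a * ((p - 1) * y) <= (p - 1) * y by rewrite ler_piMl // mulr_ge0 // subr_ge0.
have e3 : 0 <= p * y by rewrite mulr_ge0 // (le_trans ler01).
have e4 : 0 <= e * y by rewrite mulr_ge0.
rewrite ler_norml; move: l u; rewrite mulrBr mulrDr mulr1 => l u.
by apply/andP; split; lra.
Qed.

Section Density.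
Variables (K : fieldExtType rat) (d : nat) (w : d.-tuple K).
Hypothesis hR : is_order_with_basis w.
Variables (n k : nat).
Notation D := (k * n * d)%N.
Notation coeffs N := (coeffs d N n k).
Notation Bx N := (2 * N).+1.
Notation maxids X := (maxids hR X).

Definition okset N X := [set c : coeffs N | all (ok hR c) (maxids X)].
Definition alpha X : R := \prod_(M <- maxids X) delta hR n k M.

Lemma alphaE X : alpha X = \prod_((k - n).+1 <= j < k.+1) euler hR j (maxids X).
Proof. by rewrite /alpha /delta exchange_big. Qed.

Lemma alpha_bounds X : 0 <= alpha X <= 1.
Proof.
rewrite alphaE; elim/big_ind: _ => [|x y /andP[x0 x1] /andP[y0 y1]|j _].
- by rewrite ler01 lexx.
- by rewrite mulr_ge0 // mulr_ile1.
- exact: euler_bounds.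
Qed.

Lemma okset_density X : (n <= k)%N -> exists (C : R) (B0 : nat), 0 <= C /\ forall N, (B0 <= Bx N)%N ->
  `|#|okset N X|%:R / (Bx N)%:R ^+ D - alpha X| <= C / (Bx N)%:R.
Proof.
move=> nk; have m0 := fact_gt0 X; pose m := X`!.
have hm M : M \in maxids X -> phi hR M (m.-1.+1)%:R = 0.
  rewrite mem_maxids prednK // => h; apply/phi_nat_eq0/dvdn_fact.
  by rewrite h (ltnW (chr_gt1 hR M)).
(* [D] comes from the lower Bernoulli bound and [2^D] from the upper chord bound; the threshold [m]
   ensures [m / B <= 1]. *)
exists ((D%:R + 2 ^+ D) * m%:R), m; split.
  by rewrite mulr_ge0 // addr_ge0 // exprn_ge0.
move=> N hB; have /andP[] := box_ok N nk (maxids_uniq hR X) hm.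
rewrite -/(okset N X) -/(alpha X) prednK //.
have /andP[a0 a1] := alpha_bounds X.
have B0 : 0 < (Bx N)%:R :> R by rewrite ltr0n.
have BD0 : 0 < (Bx N)%:R ^+ D :> R by rewrite exprn_gt0.
pose y : R := m%:R / (Bx N)%:R.
have hy : 0 <= y <= 1.
  by rewrite /y divr_ge0 //= ler_pdivrMr // mul1r ler_nat.
set g := #|okset N X|%:R => h1 h2.
have hlo : (Bx N)%:R * (1 - y) <= (m * (Bx N %/ m))%:R :> R.
  rewrite mulrBr mulr1 /y mulrCA divff ?mulr1 ?lt0r_neq0 // lerBlDr -natrD ler_nat.
  have := ltn_ceil (Bx N) m0; rewrite mulSn -/m; lia.
have hhi : (m * (Bx N %/ m).+1)%:R <= (Bx N)%:R * (1 + y) :> R.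
  rewrite mulrDr mulr1 /y mulrCA divff ?mulr1 ?lt0r_neq0 // -natrD ler_nat.
  by have := leq_trunc_div (Bx N) m; rewrite mulnS mulnC; lia.
have /andP[y0 y1] := hy.
have l1 : alpha X * (1 - D%:R * y) <= g / (Bx N)%:R ^+ D.
  rewrite ler_pdivlMr //; apply: le_trans h1; rewrite -mulrA ler_wpM2l //.
  apply: (@le_trans _ _ (((Bx N)%:R * (1 - y)) ^+ D)).
    by rewrite exprMn mulrC ler_wpM2l ?(ltW BD0) // expr1B_ge.
  by rewrite lerXn2r ?nnegrE // mulr_ge0 // ?(ltW B0) // subr_ge0.
have u1 : g / (Bx N)%:R ^+ D <= alpha X * (1 + (2 ^+ D - 1) * y).
  rewrite ler_pdivrMr //; apply: (le_trans h2); rewrite -mulrA ler_wpM2l //.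
  apply: (@le_trans _ _ (((Bx N)%:R * (1 + y)) ^+ D)).
    by rewrite lerXn2r ?nnegrE // mulr_ge0 // ?(ltW B0) // addr_ge0.
  by rewrite exprMn mulrC ler_wpM2r ?(ltW BD0) // expr1D_le.
rewrite -mulrA -[_ / _ in leRHS]/y.
apply: two_sided_bound => //; first by rewrite a0.
by rewrite exprn_ege1 // ler1n.
Qed.

Lemma gen_sub_okset N X : [set c : coeffs N | decP (generates w (vec_of w c))] \subset okset N X.
Proof.
apply/subsetP => c; rewrite !inE => /decPP; rewrite (vec_of_mat hR) => /generatesP h.
by apply/allP => M _; apply: h.
Qed.

(** A non-generating member of [okset N X] fails at a characteristic above [X]. Those up to [B] form
    a finite sum controlled by [tail_sum]; the others give the term in [1/B]. *)
Lemma gen_density X : (n < k)%N -> (0 < X)%N -> 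
  exists (C : R) (B0 : nat), 0 <= C /\ forall N, (B0 <= Bx N)%N ->
  `|(gen_count w n k N)%:R / (Bx N)%:R ^+ D - #|okset N X|%:R / (Bx N)%:R ^+ D|
    <= n%:R * 2 ^+ D * d%:R / X%:R + C / (Bx N)%:R.
Proof.
move=> nk X0; have [C [B0 hC]] := card_large_fail hR nk.
exists C%:R, B0; split => // N hB.
have Bp : 0 < (Bx N)%:R :> R by rewrite ltr0n.
have BD0 : 0 < (Bx N)%:R ^+ D :> R by rewrite exprn_gt0.
pose s := [seq M <- maxids (Bx N) | (X < chr hR M)%N].
pose L := [set c : coeffs N | decP (exists M, (Bx N < chr hR M)%N /\ ~~ ok hR c M)].
pose G := [set c : coeffs N | decP (generates w (vec_of w c))].
have hS : (#|okset N X| <= #|G| + (#|L| + \sum_(M <- s) #|[set c : coeffs N | ~~ ok hR c M]|))%N.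
  have hU : (#|\bigcup_(M <- s) [set c : coeffs N | ~~ ok hR c M]|
      <= \sum_(M <- s) #|[set c : coeffs N | ~~ ok hR c M]|)%N.
    apply: (big_ind2 (fun (A : {set coeffs N}) m => #|A| <= m)%N) => [|A a B b hA hb|//].
      by rewrite cards0.
    by rewrite (leq_trans (leq_card_setU _ _)) // leq_add.
  apply: leq_trans (leq_add (leqnn _) (leq_trans (leq_card_setU _ _) (leq_add (leqnn _) hU))).
  apply: leq_trans (leq_card_setU _ _); apply/subset_leq_card/subsetP => c.
  rewrite !inE => /allP hok.
  have [hg|hg] := pselect (generates w (vec_of w c)); first by apply/orP; left; apply/decPP.
  apply/orP; right.
  have [M hM] : exists M, ~~ ok hR c M.
    apply: contrapT => hno; apply: hg; rewrite (vec_of_mat hR); apply/generatesP => M.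
    by case e : (row_free _) => //; exfalso; apply: hno; exists M; rewrite /ok e.
  have XM : (X < chr hR M)%N.
    by rewrite ltnNge -mem_maxids; apply: contra hM; apply: hok.
  case: (ltnP (Bx N) (chr hR M)) => hBM.
    by apply/orP; left; apply/decPP; exists M.
  apply/orP; right; have Ms : M \in s by rewrite mem_filter XM mem_maxids.
  by rewrite (big_rem M) //= !inE hM.
have hF : (\sum_(M <- s) #|[set c : coeffs N | ~~ ok hR c M]|)%N%:R
    <= n%:R * 2 ^+ D * d%:R / X%:R * (Bx N)%:R ^+ D :> R.
  rewrite natr_sum.
  apply: (@le_trans _ _ (\sum_(M <- s) n%:R / (nrm hR M)%:R ^+ 2 * (2 * Bx N)%:R ^+ D)).
    rewrite big_seq [leRHS]big_seq; apply: ler_sum => M.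
    by rewrite mem_filter mem_maxids => /andP[_ h]; apply: card_fail.
  rewrite -mulr_suml -mulr_sumr natrM exprMn.
  have -> : n%:R * 2 ^+ D * d%:R / X%:R * (Bx N)%:R ^+ D =
     n%:R * (d%:R / X%:R) * (2 ^+ D * (Bx N)%:R ^+ D) :> R by ring.
  rewrite ler_wpM2r ?mulr_ge0 ?exprn_ge0 // ler_wpM2l //.
  apply: tail_sum => //; first by rewrite filter_uniq // maxids_uniq.
  by move=> M; rewrite mem_filter => /andP[].
have hL : #|L|%:R <= C%:R / (Bx N)%:R * (Bx N)%:R ^+ D :> R.
  rewrite mulrAC ler_pdivlMr // -natrX -!natrM ler_nat; exact: hC.
have hG : (#|G| <= #|okset N X|)%N by apply/subset_leq_card/gen_sub_okset.
rewrite /gen_count -/G distrC ger0_norm; last first.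
  by rewrite -mulrBl divr_ge0 ?(ltW BD0) // subr_ge0 ler_nat.
rewrite -mulrBl ler_pdivrMr // mulrDl.
have : #|okset N X|%:R <= (#|G| + (#|L| + \sum_(M <- s) #|[set c : coeffs N | ~~ ok hR c M]|))%N%:R :> R.
  by rewrite ler_nat.
rewrite !natrD => h; rewrite lerBlDl; apply: (le_trans h); rewrite lerD2l addrC.
exact: lerD.
Qed.

Lemma densityE N : density w n k N = (gen_count w n k N)%:R / (Bx N)%:R ^+ D.
Proof.
rewrite /density RdivE !INRE natrX; congr (_ / _ ^+ _).
by rewrite mulnC mulnCA mulnC mulnAC.
Qed.

Lemma density_lt : (n < k)%N -> forall z : nat -> R,
  (forall j, (k - n < j <= k)%N -> 0 <= z j <= 1 /\
     forall X, (0 < X)%N -> `|euler hR j (maxids X) - z j| <= d%:R / X%:R) ->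
  Un_cv (density w n k) (\prod_((k - n).+1 <= j < k.+1) z j).
Proof.
(* The first summand comes from [gen_density]; the second from replacing [n] partial Euler products
   by their limits, each within [d / X]. *)
move=> nk z hz; pose A : R := n%:R * 2 ^+ D * d%:R + n%:R * d%:R.
apply: (@Un_cv_of_bounds _ _ A).
  by rewrite addr_ge0 // ?mulr_ge0 // ?exprn_ge0.
move=> X X0; have [C1 [B1 [C10 h1]]] := gen_density nk X0.
have [C2 [B2 [C20 h2]]] := okset_density X (ltnW nk).
exists (C1 + C2), (B1 + B2)%N; split; first exact: addr_ge0.
move=> N hB; rewrite densityE.
have {}h1 := h1 N (leq_trans (leq_addr _ _) hB).
have {}h2 := h2 N (leq_trans (leq_addl _ _) hB).
have h3 : `|alpha X - \prod_((k - n).+1 <= j < k.+1) z j| <= n%:R * d%:R / X%:R.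
  rewrite alphaE; apply: le_trans (prod_diff_le _ _) _.
  - by move=> j _; apply: euler_bounds.
  - by move=> j; rewrite mem_index_iota ltnS => /hz[].
  apply: (@le_trans _ _ (\sum_((k - n).+1 <= j < k.+1) d%:R / X%:R)).
    rewrite big_seq [leRHS]big_seq; apply: ler_sum => j.
    by rewrite mem_index_iota ltnS => /hz[_ h]; apply: h.
  rewrite sumr_const_nat -[leLHS]mulr_natl mulrA subSS subKn ?(ltnW nk) //.
apply: le_trans (ler_distD (#|okset N X|%:R / (Bx N)%:R ^+ D) _ _) _.
apply: le_trans (lerD h1 (le_trans (ler_distD (alpha X) _ _) (lerD h2 h3))) _.
by rewrite [C2 / _ + _]addrC addrACA /A (mulrDl C1) (mulrDl (_ * d%:R)).
Qed.
End Density.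

Lemma density_square (K : fieldExtType rat) (d : nat) (w : d.-tuple K) n :
  is_order_with_basis w -> Un_cv (density w n.+1 n.+1) 0.
Proof.
move=> hR; apply: (@Un_cv_of_bounds _ _ 0) => // X X0.
exists (n + 2 * d)%:R, 0%N; split => // N _.
have Bp : 0 < (2 * N).+1%:R :> R by rewrite ltr0n.
rewrite mul0r add0r subr0 densityE ger0_norm ?divr_ge0 ?exprn_ge0 //.
rewrite ler_pdivrMr ?exprn_gt0 // mulrAC ler_pdivlMr // -natrX -!natrM ler_nat.
exact: card_gen_square.
Qed.

Local Close Scope ring_scope.

Theorem mainTheorem3 (K : fieldExtType rat) (d : nat) (w : d.-tuple K)
  (hR : is_order_with_basis w) (n k : nat) (hn : (0 < n)%N) (hnk : (n <= k)%N) :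
  exists L : R, Un_cv (density w n k) L /\
    exists z : nat -> R,
      (forall j : nat, ((k - n).+1 <= j <= k)%N -> is_zeta_inv w j (z j)) /\
      L = \big[Rmult/R1]_((k - n).+1 <= j < k.+1) z j.
Proof.
have hz j : exists z : R, (j = 1%N -> z = 0%R) /\ ((1 < j)%N -> (0 <= z <= 1)%R /\
    forall X, (0 < X)%N -> (`|euler hR j (maxids hR X) - z| <= d%:R / X%:R)%R).
  case: (ltnP 1 j) => [j1|j1].
    by have [z hz] := euler_lim hR j1; exists z; split => [e|//]; rewrite e in j1.
  by exists 0%R; split => //; rewrite ltnNge j1.
have [z {}hz] := choice hz.
exists (\prod_((k - n).+1 <= j < k.+1) z j)%R; split; last first.
  exists z; split => // j /andP[hj _].
  case: (ltnP 1 j) => j1; first by have [_ /(_ j1)[_ h]] := hz j; apply: (is_zeta_inv_of_lim j1 h).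
  have e : j = 1%N by apply/eqP; rewrite eqn_leq j1 (leq_trans _ hj).
  by rewrite /is_zeta_inv e eqxx; have [h _] := hz 1%N; apply: h.
move: hnk; rewrite leq_eqVlt => /orP[/eqP e|nk].
  (* For [n = k] the product starts at [j = 1], where the convention makes it vanish. *)
  case: n e hn => // n <- _; rewrite subnn big_ltn //.
  by have [-> // _] := hz 1%N; rewrite mul0r; apply: density_square.
apply: (@density_lt _ _ _ hR _ _ nk z) => j /andP[j1 _].
by have [_ h] := hz j; apply: h; apply: leq_ltn_trans j1; rewrite subn_gt0.
Qed.
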